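(* Let $n\ge 1$ and let $V$ be a complex vector space of dimension $3n$. For the natural action of $\mathrm{SL}(V)$ on $S^3(V)^{\oplus 4}$ (the direct sum of four copies of the third symmetric power of $V$), we have $$\beta_{\mathrm{SL}(V)}\big(S^3(V)^{\oplus 4}\big) \ge \sigma_{\mathrm{SL}(V)}\big(S^3(V)^{\oplus 4}\big) \ge \tfrac{2}{3}(4^n-1).$$
   Context: The ground field is $\mathbb{C}$. For a rational representation $U$ of a reductive group $G$, $\mathbb{C}[U]^G=\bigoplus_{d\ge 0}\mathbb{C}[U]^G_d$ is the graded ring of polynomial invariants, and $\beta_G(U)$ is the smallest integer $D\ge 0$ such that the homogeneous invariants of degree $\le D$ generate $\mathbb{C}[U]^G$ as a $\mathbb{C}$-algebra. The null cone $\mathcal{N}\subseteq U$ is the common zero set of all homogeneous invariants of positive degree; $\sigma_G(U)$ is the smallest integer $D\ge 0$ such that $\mathcal{N}$ equals the common zero set of the homogeneous invariants of degrees $1,\dots,D$. *)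

(* Defs.v *)
From HB Require Import structures.
From mathcomp Require Import all_boot all_order all_algebra.
From mathcomp Require Import complex.
From mathcomp Require Import all_classical all_reals ereal.
(* The notations of mpoly clash with those of the reals library. *)
From mathcomp Require Import -(notations) mpoly.

Set Implicit Arguments.
Unset Strict Implicit.
Unset Printing Implicit Defensive.

Import Order.TTheory GRing.Theory Num.Theory.
Local Open Scope classical_set_scope.
Local Open Scope ring_scope.

Notation "{ 'mpoly' T [ n ] }" := (mpoly n T).
Notation homogeneous d := (ishomog1 d mdeg).

Section Invariants.

Context {R : realType} {U : lmodType R[i]} {G : Type}.
Implicit Types (f : U -> R[i]) (act : G -> U -> U) (d D : nat).

(* Polynomial functions are the polynomial expressions in linear forms; for
   finite-dimensional U they are the elements of C[U]. *)
Definition polynomial_function f : Prop :=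
  exists (k : nat) (l : 'I_k -> {scalar U}) (p : {mpoly R[i][k]}),
    forall u, f u = meval (fun j => l j u) p.

Definition homogeneous_function d f : Prop :=
  exists (k : nat) (l : 'I_k -> {scalar U}) (p : {mpoly R[i][k]}),
    p \is homogeneous d /\ forall u, f u = meval (fun j => l j u) p.

Definition invariant act f : Prop := forall g u, f (act g u) = f u.

Definition homogeneous_invariant act d f : Prop :=
  homogeneous_function d f /\ invariant act f.

Definition invariants_generated_up_to act D : Prop :=
  forall f, polynomial_function f -> invariant act f ->
  exists (k : nat) (h : 'I_k -> U -> R[i]) (q : {mpoly R[i][k]}),
    (forall j, exists2 d, (d <= D)%N & homogeneous_invariant act d (h j)) /\
    forall u, f u = meval (fun j => h j u) q.

Definition null_cone act : set U :=
  [set u | forall d f, (0 < d)%N -> homogeneous_invariant act d f -> f u = 0].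

Definition zero_set_up_to act D : set U :=
  [set u | forall d f, (0 < d <= D)%N -> homogeneous_invariant act d f ->
    f u = 0].

(* The smallest element of a set of natural numbers, as an extended real; it is
   +oo when the set is empty. *)
Definition smallest_nat (P : set nat) : \bar R :=
  ereal_inf [set (D%:R : R)%:E | D in P].

Definition beta act : \bar R :=
  smallest_nat [set D | invariants_generated_up_to act D].

Definition sigma act : \bar R :=
  smallest_nat [set D | null_cone act = zero_set_up_to act D].

End Invariants.

Section SymmetricPower.

Context {F : fieldType} (V : vectType F).

Let N := \dim {:V}.
Let b : N.-tuple V := vbasis {:V}.

(* The symmetric algebra of V is the polynomial ring in the vectors of the basis
   b; S^d(V) is its component of degree d. *)
Definition Sym (d : nat) : lmodType F := dhomog N F d.

Definition sym_of_vect (v : V) : {mpoly F[N]} :=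
  \sum_(j < N) coord b j v *: mpolyX F (mnm1 j).

Definition sym_map (g : 'End(V)) (p : {mpoly F[N]}) : {mpoly F[N]} :=
  comp_mpoly [tuple sym_of_vect (g (tnth b i)) | i < N] p.

Lemma sym_map_of_vect g v : sym_map g (sym_of_vect v) = sym_of_vect (g v).
Proof.
rewrite /sym_map {1}/sym_of_vect raddf_sum /=.
under eq_bigr => j _ do
  rewrite linearZ /= comp_mpolyXU -tnth_nth tnth_mktuple scaler_sumr.
rewrite exchange_big /=; apply: eq_bigr => k _.
under eq_bigr do rewrite scalerA.
rewrite -scaler_suml; congr (_ *: _).
rewrite {2}(coord_vbasis (memvf v)) linear_sum /= linear_sum /=.
by apply: eq_bigr => j _; rewrite !linearZ /= -tnth_nth.
Qed.

Lemma sym_of_vect_homog v : sym_of_vect v \is homogeneous 1.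
Proof.
apply: rpred_sum => j _; apply: rpredZ.
by rewrite dhomogX /= mdeg1.
Qed.

Lemma sym_map_homog g d p :
  p \is homogeneous d -> sym_map g p \is homogeneous d.
Proof.
move=> /dhomogP hp; rewrite /sym_map comp_mpolyE big_seq.
apply: rpred_sum => m /hp hm; apply: rpredZ.
rewrite -{}hm /= mdegE.
elim/big_rec2: _ => [|i y x _ hx]; first exact: dhomog1.
apply: dhomogM => //; rewrite tnth_mktuple.
by have := dhomogMn (m i) (sym_of_vect_homog (g (tnth b i))); rewrite mul1n.
Qed.

Definition sym_act (g : 'End(V)) (d : nat) (p : Sym d) : Sym d :=
  DHomog (sym_map_homog g (valP p)).

Definition lfun_det (g : 'End(V)) : F := \det (passmx.mxof b b g).

Definition SL : Type := {g : 'End(V) | lfun_det g == 1}.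

Definition SL_act_cubics (m : nat) (g : SL) (u : {ffun 'I_m -> Sym 3}) :
    {ffun 'I_m -> Sym 3} :=
  [ffun i => sym_act (val g) (u i)].

End SymmetricPower.

Arguments SL_act_cubics {F} V m g u.

(* Main.v *)
From HB Require Import structures.
From mathcomp Require Import all_boot all_order all_fingroup all_algebra.
From mathcomp Require Import complex.
From mathcomp Require Import all_classical all_reals ereal.
From mathcomp Require Import ssrcomplements.
From mathcomp Require Import -(notations) mpoly.
From mathcomp Require Import ring lra zify.
Require Import Defs.

(* Write N = 3n and consider the monomials x_a^2 x_b, where b is the successor of
   a in the sequence 0, N-1, 1, N-2, ... of all variables, the last variable
   being its own successor. Let q be the sum of these monomials, those with a in
   the lower half being put in the first copy of S^3(V) and the others in the
   second one; the last two copies are zero.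

   Low degrees. Along the orbit of q under the diagonal torus of SL(V), an
   invariant of degree d is a combination of monomials with exponents e_a, and
   torus invariance forces all variables to occur with one multiplicity k. Along
   the sequence this reads 2 e_0 = k and 2 e_(i+1) + e_i = k, hence 2^(N-1)
   divides k, while 3 d = N k. So an invariant of positive degree
   d < n 2^(3n-1) vanishes at q.

   Non-nullity. Let X be a generic N x N matrix. Pairing with det(X)^k for the
   apolar inner product turns every polynomial in the coordinates of X q into an
   invariant. If all invariants of positive degree vanished at q, then det(X)
   would not be integral over the algebra generated by the coordinates of X q, so
   some valuation ring O would contain these coordinates, but not det(X). Column
   operations over O make X lower triangular. Since the monomials of q in each
   copy form an antichain for the order induced by lowering indices, O then
   contains t_a^2 t_b for the diagonal entries t, and therefore a power of their
   product, a contradiction. *)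

Set Implicit Arguments.
Unset Strict Implicit.
Unset Printing Implicit Defensive.

Import Order.TTheory GRing.Theory Num.Theory.
Local Open Scope classical_set_scope.
Local Open Scope ring_scope.

Local Notation "p @_ m" := (mcoeff m p)
  (at level 3, m at level 2, left associativity, format "p @_ m") : ring_scope.
Local Notation "p .@[ v ]" := (meval v p)
  (at level 3, left associativity, format "p .@[ v ]") : ring_scope.
Local Notation "''X_' k" := (mpolyX _ (mnm1 k))
  (at level 8, k at level 2, format "''X_' k") : ring_scope.
Local Notation "''X_[' m ]" := (mpolyX _ m)
  (at level 8, m at level 2, format "''X_[' m ]") : ring_scope.
Local Notation "''U_(' k )" := (mnm1 k)
  (at level 0, k at level 2, format "''U_(' k )").

(** * Valuation rings *)

Section ValuationRings.

Context {K : fieldType}.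
Implicit Types (A O : set K) (x z : K).

Definition subring A : Prop :=
  [/\ A 1, forall x y, A x -> A y -> A (x - y)
    & forall x y, A x -> A y -> A (x * y)].

Lemma subring0 A : subring A -> A 0.
Proof. by case=> A1 AB _; have := AB _ _ A1 A1; rewrite subrr. Qed.

Lemma subringN A x : subring A -> A x -> A (- x).
Proof.
move=> Ar Ax; rewrite -sub0r; case: (Ar) => _ AB _.
by apply: AB => //; apply: subring0.
Qed.

Lemma subringD A x y : subring A -> A x -> A y -> A (x + y).
Proof.
move=> Ar Ax Ay; rewrite -[y]opprK; case: (Ar) => _ AB _.
by apply: (AB) => //; apply: subringN.
Qed.

Lemma subring_sum A (I : Type) (r : seq I) (P : pred I) (f : I -> K) :
  subring A -> (forall i, P i -> A (f i)) -> A (\sum_(i <- r | P i) f i).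
Proof.
move=> Ar Af; elim/big_ind: _ => //; first exact: subring0.
by move=> x y; apply: subringD.
Qed.

Lemma subringX A x k : subring A -> A x -> A (x ^+ k).
Proof.
by move=> [A1 _ AM] Ax; elim: k => [|k IH]; rewrite ?expr0 // exprS; apply: (AM).
Qed.

Definition adjoin A z : set K :=
  [set w | exists2 p : {poly K}, (forall i, A p`_i) & w = p.[z]].

Lemma sub_adjoin A z : subring A -> A `<=` adjoin A z.
Proof.
move=> Ar x Ax; exists x%:P; last by rewrite hornerC.
by move=> i; rewrite coefC; case: ifP => // _; apply: subring0.
Qed.

Lemma mem_adjoin A z : subring A -> adjoin A z z.
Proof.
move=> Ar; exists 'X; last by rewrite hornerX.
move=> i; rewrite coefX; case: (Ar) => A1 _ _.
by case: (i == 1)%N => //; apply: subring0.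
Qed.

Lemma adjoin_subring A z : subring A -> subring (adjoin A z).
Proof.
move=> Ar; split=> [|x y [p Ap ->] [q Aq ->]|x y [p Ap ->] [q Aq ->]].
- by apply: sub_adjoin => //; case: Ar.
- exists (p - q); last by rewrite hornerD hornerN.
  by move=> i; rewrite coefB; case: Ar => _ AB _; apply: (AB).
- exists (p * q); last by rewrite hornerM.
  move=> i; rewrite coefM; apply: subring_sum => // j _.
  by case: Ar => _ _; apply.
Qed.

Definition expansion A x z p : Prop :=
  exists2 c : nat -> K, (forall i, A (c i)) & x = \sum_(i < p.+1) c i * z ^+ i.

Lemma expansion_widen A x z p q : subring A -> (p <= q)%N ->
  expansion A x z p -> expansion A x z q.
Proof.
move=> Ar pq [c Ac ->]; exists (fun i => if (i < p.+1)%N then c i else 0).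
  by move=> i; case: ifP => // _; apply: subring0.
rewrite (big_ord_widen q.+1 (fun i => c i * z ^+ i)) // big_mkcond.
by apply: eq_bigr => i _; case: ifP => //; rewrite mul0r.
Qed.

Lemma expansion_adjoin A x z : subring A -> adjoin A z x ->
  exists p, expansion A x z p.
Proof.
move=> Ar [c Ac ->]; exists (size c), (fun i => c`_i) => //.
by apply: horner_coef_wide.
Qed.

(* Multiplying [x = \sum_i c_i z^i] by [1 - x^-1 e_0], whose product with
   [z^(p+1)] is a combination of lower powers of [z], eliminates the leading
   term. *)
Lemma expansion_descent A x z p : subring A -> x != 0 -> A x^-1 -> z != 0 ->
  expansion A x z p.+1 -> expansion A x z^-1 p.+1 -> expansion A x z p.
Proof.
move=> Ar x0 Ay z0 [c Ac xc] [e Ae xe]; case: (Ar) => A1 AB AM.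
pose c' i := (if i == 0%N then e 0%N else 0) + (1 - x^-1 * e 0%N) * c i
             + c p.+1 * x^-1 * e (p.+1 - i)%N.
exists c'.
  move=> i; apply: subringD => //; last by apply: (AM) => //; apply: (AM).
  apply: subringD => //; first by case: ifP => // _; apply: subring0.
  by apply: (AM) => //; apply: (AB) => //; apply: (AM).
have r_def : \sum_(i < p.+1) e (p.+1 - i)%N * z ^+ i = (x - e 0%N) * z ^+ p.+1.
  have -> : x - e 0%N = \sum_(i < p.+1) e i.+1 * z^-1 ^+ i.+1.
    by rewrite {1}xe big_ord_recl /= expr0 mulr1 addrAC subrr add0r.
  rewrite (reindex_inj rev_ord_inj) /= mulr_suml; apply: eq_bigr => i _.
  rewrite -mulrA; have ip := ltn_ord i; congr (e _ * _); first by lia.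
  by rewrite exprVn -[X in _ * z ^+ X](subnKC ip) exprD mulKf ?expf_neq0.
under eq_bigr do rewrite /c' !mulrDl -!mulrA.
rewrite !big_split /= -!mulr_sumr r_def.
have -> : \sum_(i < p.+1) (if i == 0%N :> nat then e 0%N else 0) * z ^+ i = e 0%N.
  rewrite big_ord_recl /= expr0 mulr1 big1 ?addr0 // => i _.
  by rewrite mul0r.
have c_def : \sum_(i < p.+1) c i * z ^+ i = x - c p.+1 * z ^+ p.+1.
  by rewrite [X in _ = X - _]xc [X in _ = X - _]big_ord_recr /= addrK.
rewrite c_def; field.
by [].
Qed.

(** Chevalley's argument, by induction on the sum of the two degrees: the longer expansion is
    shortened with the help of the other one. An expansion of degree 0 would put [x] in [A]. *)
Lemma not_adjoin_both A x z : subring A -> x != 0 -> A x^-1 -> ~ A x ->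
  z != 0 -> adjoin A z x -> adjoin A z^-1 x -> False.
Proof.
move=> Ar x0 Ay nAx z0 /(expansion_adjoin Ar)[p ep] /(expansion_adjoin Ar)[q eq].
have [m] := ubnP (p + q); elim: m => // m IH in p q z z0 ep eq *; move=> pqm.
have expansion0 w : expansion A x w 0 -> A x.
  by case=> c Ac ->; rewrite big_ord1 expr0 mulr1.
case: p => [|p] in ep pqm *; first exact/nAx/(expansion0 _ ep).
case: q => [|q] in eq pqm *; first exact/nAx/(expansion0 _ eq).
case: (leqP q p) => qp.
  apply: (IH p q.+1 z) => //.
  by apply: expansion_descent => //; apply: expansion_widen eq => //.
apply: (IH p.+1 q z) => //; last by rewrite addSnnS.
apply: expansion_descent; rewrite ?invr_eq0 ?invrK //.
by apply: expansion_widen ep => //; lia.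
Qed.

(** Zorn's lemma gives a subring [O] maximal among those containing [A] and avoiding [x]. If it
    contained neither [z] nor [z^-1], adjoining either would capture [x], against
    [not_adjoin_both]. *)
Lemma valuation_ring_exists A x :
  subring A -> x != 0 -> A x^-1 -> ~ A x ->
  exists O, [/\ subring O, A `<=` O, ~ O x & forall z, O z \/ O z^-1].
Proof.
move=> Ar x0 Ay nAx.
pose P : set (set K) := [set X | X = set0 \/ [/\ subring X, A `<=` X & ~ X x]].
have [F FP Ftot|O [OP Omax]] := @Zorn_bigcup K P.
  have [[X FX [t Xt]]|F0] := pselect (exists2 X, F X & X !=set0); last first.
    left; rewrite -subset0 => t [X FX Xt]; apply: F0; exists X => //.
    by exists t.
  have inP Y u : F Y -> Y u -> [/\ subring Y, A `<=` Y & ~ Y x].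
    by move=> /FP[->|].
  have [Xr AX _] := inP _ _ FX Xt.
  right; split; last first.
  - by move=> [Y FY Yx]; have [_ _] := inP _ _ FY Yx; apply.
  - by move=> u /AX Xu; exists X.
  have two u v : (\bigcup_(Y in F) Y) u -> (\bigcup_(Y in F) Y) v ->
      exists Y, [/\ F Y, subring Y, Y u & Y v].
    move=> [Y FY Yu] [Z FZ Zv].
    have [Yr _ _] := inP _ _ FY Yu; have [Zr _ _] := inP _ _ FZ Zv.
    have [YZ|ZY] := Ftot _ _ FY FZ.
    + by exists Z; split=> //; apply: YZ.
    + by exists Y; split=> //; apply: ZY.
  split; first by exists X => //; case: Xr.
  - move=> u v Uu Uv; have [Y [FY [_ YB _] Yu Yv]] := two _ _ Uu Uv.
    by exists Y => //; apply: YB.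
  - move=> u v Uu Uv; have [Y [FY [_ _ YM] Yu Yv]] := two _ _ Uu Uv.
    by exists Y => //; apply: YM.
have [Or AO nOx] : [/\ subring O, A `<=` O & ~ O x].
  case: OP => // O0; exfalso; apply: (Omax A); last by right; split.
  by rewrite O0; split=> // /(_ 1) H; case: Ar => A1 _ _; exact: H A1.
exists O; split=> // z.
have [->|z0] := eqVneq z 0; first by left; apply: subring0.
apply: contrapT => /not_orP[nOz nOz'].
have step w : ~ O w -> adjoin O w x.
  move=> nOw; apply: contrapT => nx; apply: (Omax (adjoin O w)).
    split; first exact: sub_adjoin.
    by move/(_ _ (mem_adjoin w Or)).
  right; split=> //; first exact: adjoin_subring.
  by move=> u /AO; apply: sub_adjoin.
by apply: (@not_adjoin_both O x z) => //; [exact: AO | exact: step | exact: step].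
Qed.

(** * Column reduction over a valuation ring *)

Section ColumnReduction.

Variable O : set K.
Hypotheses (Or : subring O) (Ov : forall z, O z \/ O z^-1).

(** Of two elements of [K] one divides the other over [O], so a nonempty finite family has a member
    dividing all of them. *)
Lemma pivot n (r : 'I_n.+1 -> K) :
  exists j0, forall j, exists2 a, O a & r j = r j0 * a.
Proof.
have O1 : O 1 by case: Or.
elim: n r => [|n IH] r.
  by exists ord0 => j; exists 1 => //; rewrite mulr1 !ord1.
have [j0 Hj0] := IH (fun j => r (lift ord0 j)).
have [dvd|ndvd] := pselect (exists2 a, O a & r ord0 = r (lift ord0 j0) * a).
  by exists (lift ord0 j0) => j; case: (unliftP ord0 j) => [k|] ->.
exists ord0 => j.
have [a Oa ra] : exists2 a, O a & r (lift ord0 j0) = r ord0 * a.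
  have [r0|r0] := eqVneq (r (lift ord0 j0)) 0.
    by exists 0; rewrite ?mulr0 //; apply: subring0.
  have [r1|r1] := eqVneq (r ord0) 0.
    by case: ndvd; exists 0; rewrite ?mulr0 //; apply: subring0.
  have [Oz|Oz] := Ov (r ord0 / r (lift ord0 j0)).
    by case: ndvd; exists (r ord0 / r (lift ord0 j0)) => //; field.
  by exists (r ord0 / r (lift ord0 j0))^-1 => //; field; rewrite r0.
case: (unliftP ord0 j) => [k|] ->; last by exists 1; rewrite ?mulr1.
have [b Ob ->] := Hj0 k; exists (a * b); last by rewrite ra mulrA.
by case: Or => _ _; apply.
Qed.

Lemma mulmx_subring m n p (B : 'M[K]_(m, n)) (C : 'M[K]_(n, p)) :
  (forall i j, O (B i j)) -> (forall i j, O (C i j)) ->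
  forall i j, O ((B *m C) i j).
Proof.
move=> BO CO i j; rewrite mxE; apply: subring_sum => // k _.
by case: Or => _ _; apply.
Qed.

Lemma block_mx_subring m1 m2 n1 n2 (B1 : 'M[K]_(m1, n1))
    (B2 : 'M[K]_(m1, n2)) (B3 : 'M[K]_(m2, n1)) (B4 : 'M[K]_(m2, n2)) :
  (forall i j, O (B1 i j)) -> (forall i j, O (B2 i j)) ->
  (forall i j, O (B3 i j)) -> (forall i j, O (B4 i j)) ->
  forall i j, O ((block_mx B1 B2 B3 B4) i j).
Proof.
move=> O1 O2 O3 O4 k l; rewrite -[k]splitK -[l]splitK.
by case: (fintype.split k) => {}k; case: (fintype.split l) => {}l /=;
  rewrite ?(block_mxEul, block_mxEur, block_mxEdl, block_mxEdr).
Qed.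

(** Column elimination: a pivot dividing the first row is moved to the front, the rest of the row is
    cleared, and the induction treats the lower right block. Column swaps leave the determinant
    known only up to sign, hence the square. *)
Lemma trigonalize n (M : 'M[K]_n) : exists C : 'M[K]_n,
  [/\ forall i j, O (C i j), \det C ^+ 2 = 1 & is_trig_mx (M *m C)].
Proof.
have [O1 _ _] := Or; have O0 := subring0 Or.
have O01 (b : bool) : O b%:R by case: b.
elim: n M => [|n IH] M.
  exists 1%:M; split=> [[]||] //; first by rewrite det1 expr1n.
  by apply/is_trig_mxP=> -[].
have [j0 Hj0] := pivot (fun j => M ord0 j).
pose S : 'M[K]_(1 + n) := tperm_mx ord0 j0.
pose M1 : 'M[K]_(1 + n) := M *m S.
have M1_pivot j : exists2 a, O a & M1 ord0 j = M1 ord0 ord0 * a.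
  by rewrite /M1 /S -xcolE !mxE tpermL; apply: Hj0.
have M1E : M *m S = M1 by [].
move: (M1) M1E M1_pivot => {}M1 M1E M1_pivot.
have {M1_pivot} [a Oa aE] : exists2 a : 'rV[K]_n, (forall i j, O (a i j)) &
    ursubmx M1 = ulsubmx M1 *m a.
  have [a Ha] : {a : 'I_n -> K & forall j,
      O (a j) /\ M1 ord0 (rshift 1 j) = M1 ord0 ord0 * a j}.
    have Hc j : exists b, O b /\ M1 ord0 (rshift 1 j) = M1 ord0 ord0 * b.
      by have [b] := M1_pivot (rshift 1 j); exists b.
    exact: (boolp.choice Hc).
  exists (\row_j a j) => [i j|]; first by rewrite mxE; case: (Ha j).
  apply/matrixP => i j; rewrite ord1 !mxE big_ord1 !mxE.
  have -> : lshift n (0 : 'I_1) = ord0 by apply: val_inj.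
  by case: (Ha j).
pose E : 'M[K]_(1 + n) := block_mx 1%:M (- a) 0 1%:M.
have [C' [OC' dC' tC']] := IH (dlsubmx M1 *m - a + drsubmx M1).
exists (S *m E *m block_mx 1%:M 0 0 C'); split.
- apply: mulmx_subring; first apply: mulmx_subring.
  + by move=> i j; rewrite !mxE.
  + apply: (@block_mx_subring 1 n 1 n) => i j; rewrite !mxE //.
    exact: subringN.
  + by apply: (@block_mx_subring 1 n 1 n) => // i j; rewrite !mxE.
- rewrite !det_mulmx -[E]/(block_mx _ _ _ _).
  rewrite (@det_ublock _ 1 n) (@det_lblock _ 1 n) !det1 !mul1r mulr1 exprMn.
  rewrite dC' mulr1.
  by rewrite /S det_perm sqrr_sign.
- rewrite !mulmxA M1E -(@submxK _ 1 n 1 n M1) /E aE !(@mulmx_block _ 1 n 1 n 1 n).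
  rewrite !(mulmx0, mul0mx, mulmx1, addr0, add0r) mulmxN addNr mul0mx.
  rewrite (@is_trig_block_mx _ 1 n 1 n) // eqxx /= tC' andbT.
  by apply/is_trig_mxP => i j; rewrite !ord1.
Qed.

End ColumnReduction.
End ValuationRings.

(** * Linear substitutions *)

HB.lock Definition lsubst (S : comNzRingType) k l (A : 'M[S]_(k, l))
    (p : {mpoly S[k]}) : {mpoly S[l]} :=
  comp_mpoly [tuple \sum_j A i j *: 'X_j | i < k] p.

Section LinearSubstitution.

Context {S : comNzRingType}.

Lemma lsubstE k l (A : 'M[S]_(k, l)) :
  lsubst A = comp_mpoly [tuple \sum_j A i j *: 'X_j | i < k].
Proof. by rewrite lsubst.unlock. Qed.

Lemma lsubst_is_linear k l (A : 'M[S]_(k, l)) : linear (lsubst A).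
Proof. by rewrite lsubstE; apply: linearP. Qed.

HB.instance Definition _ k l (A : 'M[S]_(k, l)) :=
  GRing.isLinear.Build S {mpoly S[k]} {mpoly S[l]} *:%R (lsubst A)
    (lsubst_is_linear A).

Lemma lsubst_is_monoid_morphism k l (A : 'M[S]_(k, l)) :
  monoid_morphism (lsubst A).
Proof.
by rewrite lsubstE; split=> [|p q]; [apply: rmorph1 | apply: rmorphM].
Qed.

HB.instance Definition _ k l (A : 'M[S]_(k, l)) :=
  GRing.isMonoidMorphism.Build {mpoly S[k]} {mpoly S[l]} (lsubst A)
    (lsubst_is_monoid_morphism A).

Lemma lsubstC k l (A : 'M[S]_(k, l)) c : lsubst A (mpolyC k c) = mpolyC l c.
Proof. by rewrite lsubstE comp_mpolyC. Qed.

Lemma lsubstX k l (A : 'M[S]_(k, l)) m :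
  lsubst A (mpolyX S m) = \prod_i (\sum_j A i j *: 'X_j) ^+ m i.
Proof.
rewrite lsubstE comp_mpolyX; apply: eq_bigr => i _.
by rewrite tnth_mktuple.
Qed.

Lemma lsubstXU k l (A : 'M[S]_(k, l)) i : lsubst A 'X_i = \sum_j A i j *: 'X_j.
Proof. by rewrite lsubstE comp_mpolyXU -tnth_nth tnth_mktuple. Qed.

Lemma meval_lsubst k l (A : 'M[S]_(k, l)) p v :
  (lsubst A p).@[v] = p.@[fun i => \sum_j A i j * v j].
Proof.
rewrite lsubstE comp_mpoly_meval; apply: meval_eq => i.
rewrite tnth_mktuple raddf_sum /=; apply: eq_bigr => j _.
by rewrite mevalZ mevalXU.
Qed.

Lemma rmorph_mpoly_ext k (T : nzRingType) (f g : {rmorphism {mpoly S[k]} -> T}) :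
  (forall c, f (mpolyC k c) = g (mpolyC k c)) ->
  (forall i, f 'X_i = g 'X_i) -> f =1 g.
Proof.
move=> fgC fgX p; rewrite (mpolyE p) !raddf_sum /=; apply: eq_bigr => m _.
rewrite -mul_mpolyC !rmorphM /= fgC mpolyXE_id !rmorph_prod /=; congr (_ * _).
by apply: eq_bigr => i _; rewrite !rmorphXn /= fgX.
Qed.

Lemma lsubst_comp k l r (A : 'M[S]_(k, l)) (B : 'M[S]_(l, r)) p :
  lsubst B (lsubst A p) = lsubst (A *m B) p.
Proof.
pose f : {rmorphism {mpoly S[k]} -> {mpoly S[r]}} := lsubst B \o lsubst A.
apply: (rmorph_mpoly_ext (f := f) (g := lsubst (A *m B))) => [c|i].
  by rewrite /= !lsubstC.
rewrite /= !lsubstXU raddf_sum /=.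
under eq_bigr do rewrite linearZ /= lsubstXU scaler_sumr.
rewrite exchange_big /=; apply: eq_bigr => j _; rewrite mxE scaler_suml.
by apply: eq_bigr => a _; rewrite scalerA.
Qed.

Lemma lsubst_homog k l (A : 'M[S]_(k, l)) d p :
  p \is homogeneous d -> lsubst A p \is homogeneous d.
Proof.
move=> /dhomogP hp; rewrite (mpolyE p) raddf_sum /= big_seq; apply: rpred_sum.
move=> m /hp <-; rewrite linearZ /= lsubstX; apply: rpredZ.
rewrite mdegE; elim/big_rec2: _ => [|i y x _ hx]; first exact: dhomog1.
apply: dhomogM => //.
have h1 : (\sum_j A i j *: 'X_j : {mpoly S[l]}) \is homogeneous 1.
  by apply: rpred_sum => j _; apply: rpredZ; rewrite dhomogX /= mdeg1.
by have := dhomogMn (m i) h1; rewrite mul1n.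
Qed.

End LinearSubstitution.

Lemma map_lsubst (S T : comNzRingType) (f : {rmorphism S -> T}) k l
    (A : 'M[S]_(k, l)) p :
  map_mpoly f (lsubst A p) = lsubst (map_mx f A) (map_mpoly f p).
Proof.
pose g : {rmorphism {mpoly S[k]} -> {mpoly T[l]}} := map_mpoly f \o lsubst A.
pose h : {rmorphism {mpoly S[k]} -> {mpoly T[l]}} :=
  lsubst (map_mx f A) \o map_mpoly f.
apply: (rmorph_mpoly_ext (f := g) (g := h)) => [c|i].
  by rewrite /= lsubstC !map_mpolyC lsubstC.
rewrite /= lsubstXU raddf_sum /= map_mpolyX lsubstXU; apply: eq_bigr => j _.
by rewrite map_mpolyZ map_mpolyX mxE.
Qed.

(** * Polynomials vanishing at every point *)

Lemma base_expansion_inj k d (m m' : 'I_k -> nat) :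
  (forall i, m i < d)%N -> (forall i, m' i < d)%N ->
  (\sum_i m i * d ^ i = \sum_i m' i * d ^ i)%N -> m =1 m'.
Proof.
elim: k m m' => [|k IH] m m' md md'; first by move=> _ [].
have split_sum u : (\sum_(i < k.+1) u i * d ^ i =
    u ord0 + (\sum_(i < k) u (lift ord0 i) * d ^ i) * d)%N.
  rewrite big_ord_recl /= expn0 muln1; congr addn.
  by rewrite big_distrl /=; apply: eq_bigr => i _; rewrite expnSr mulnA.
rewrite !split_sum => E.
have d0 : (0 < d)%N by apply: leq_ltn_trans (md ord0).
have E0 : m ord0 = m' ord0.
  by have := congr1 (modn^~ d) E; rewrite /= !(addnC (_ ord0)) !modnMDl !modn_small.
move=> i; case: (unliftP ord0 i) => [j|] -> //.
apply: (IH (fun j => m (lift ord0 j)) (fun j => m' (lift ord0 j))) => //.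
move: E; rewrite E0 => /addnI /eqP; rewrite eqn_pmul2r // => /eqP.
exact.
Qed.

Section NumField.

Context {F : numFieldType}.

Lemma poly_eq0_of_horner (p : {poly F}) : (forall x, p.[x] = 0) -> p = 0.
Proof.
move=> p0; apply/eqP; apply: contraT => pN0.
pose s := [seq (i%:R : F) | i <- iota 0 (size p)].
have := @max_poly_roots _ p s pN0; rewrite size_map size_iota ltnn; apply.
  by apply/allP => x _; rewrite /root p0.
by rewrite map_inj_uniq ?iota_uniq // => i j /eqP; rewrite eqr_nat => /eqP.
Qed.

(* Kronecker's substitution [X_i := x ^ (d ^ i)] reduces to one variable. *)
Lemma mpoly_eq0_of_meval k (p : {mpoly F[k]}) : (forall v, p.@[v] = 0) -> p = 0.
Proof.
move=> p0; set d := msize p.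
pose w (m : multinom k) := (\sum_i m i * d ^ i)%N.
pose q : {poly F} := \sum_(m <- msupp p) p@_m *: 'X^(w m).
have q0 : q = 0.
  apply: poly_eq0_of_horner => x; rewrite -[RHS](p0 (fun i => x ^+ (d ^ i))).
  rewrite mevalE horner_sum; apply: eq_bigr => m _.
  rewrite hornerZ hornerXn /w expr_sum; congr (_ * _).
  by apply: eq_bigr => i _; rewrite -exprM mulnC.
apply/mpolyP => m; rewrite mcoeff0.
have [mp|/memN_msupp_eq0//] := boolP (m \in msupp p).
have := congr1 (fun r : {poly F} => r`_(w m)) q0; rewrite coef0 /q coef_sum.
rewrite (bigD1_seq m) ?msupp_uniq //= coefZ coefXn eqxx mulr1.
rewrite big_seq_cond big1 ?addr0 // => m' /andP[m'p m'm].
rewrite coefZ coefXn; case: eqP => [E|]; last by rewrite mulr0.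
have lt_d u i : u \in msupp p -> (u i < d)%N.
  move=> /msize_mdeg_lt; apply: leq_ltn_trans.
  by rewrite mdegE (bigD1 i) //= leq_addr.
case/eqP: m'm; apply/mnmP => i.
by apply: base_expansion_inj (esym E) i => i; apply: lt_d.
Qed.

End NumField.

(** * The apolar pairing *)

Section Apolar.

Context {F : comNzRingType} {k : nat}.
Implicit Types (f g h p : {mpoly F[k]}) (m : multinom k).

(** This is [f(d/dX) h] evaluated at the origin; the factorials make multiplication by a variable
    adjoint to the partial derivative. *)
Definition apolar f h : F :=
  \sum_(m <- msupp f) f@_m * h@_m * (\prod_i (m i)`!)%:R.

Lemma apolarwE d f h : (msize f <= d)%N ->
  apolar f h = \sum_(m : bmultinom k d) f@_m * h@_m * (\prod_i (m i)`!)%:R.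
Proof.
move=> fd; pose I : subFinType _ := bmultinom k d.
rewrite /apolar (big_mksub I) ?msupp_uniq //=; last first.
  by move=> m /msize_mdeg_lt /leq_trans; apply.
by rewrite big_rmcond //= => j /memN_msupp_eq0 ->; rewrite !mul0r.
Qed.

Lemma apolar_linear h : scalar (apolar^~ h).
Proof.
move=> c f g; pose d := maxn (maxn (msize f) (msize g)) (msize (c *: f + g)).
rewrite !(@apolarwE d) ?leq_max ?leqnn ?orbT // mulr_sumr -big_split /=.
by apply: eq_bigr => m _; rewrite mcoeffD mcoeffZ !mulrDl !mulrA.
Qed.

Lemma apolarC f h : apolar f h = apolar h f.
Proof.
pose d := maxn (msize f) (msize h).
rewrite !(@apolarwE d) ?leq_max ?leqnn ?orbT //.
by apply: eq_bigr => m _; rewrite (mulrC f@_m).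
Qed.

Lemma apolarDl f g h : apolar (f + g) h = apolar f h + apolar g h.
Proof. by have := apolar_linear h 1 f g; rewrite /= scale1r mul1r. Qed.

Lemma apolar0l h : apolar 0 h = 0.
Proof. by rewrite /apolar msupp0 big_nil. Qed.

Lemma apolarZl c f h : apolar (c *: f) h = c * apolar f h.
Proof. by have := apolar_linear h c f 0; rewrite /= addr0 apolar0l addr0. Qed.

Lemma apolarZr c f h : apolar f (c *: h) = c * apolar f h.
Proof. by rewrite apolarC apolarZl apolarC. Qed.

Lemma apolar_suml (I : Type) (r : seq I) (P : pred I) (f : I -> {mpoly F[k]}) h :
  apolar (\sum_(i <- r | P i) f i) h = \sum_(i <- r | P i) apolar (f i) h.
Proof. exact: (big_morph _ (fun f g => apolarDl f g h) (apolar0l h)). Qed.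

Lemma apolarX m h : apolar 'X_[m] h = h@_m * (\prod_i (m i)`!)%:R.
Proof. by rewrite /apolar msuppX big_seq1 mcoeffX eqxx mul1r. Qed.

Lemma mpoly_ind_mulX (P : {mpoly F[k]} -> Prop) :
  P 1 -> (forall c f, P f -> P (c *: f)) ->
  (forall f g, P f -> P g -> P (f + g)) -> (forall i f, P f -> P ('X_i * f)) ->
  forall f, P f.
Proof.
move=> P1 PZ PD PX f; rewrite (mpolyE f); elim/big_ind: _ => //.
  by rewrite -(scale0r 1); apply: PZ.
move=> m _; apply: PZ.
have [d] := ubnP (mdeg m); elim: d m => // d IH m; rewrite ltnS => md.
have [m0|] := eqVneq (mdeg m) 0%N.
  by move/eqP: m0; rewrite mdeg_eq0 => /eqP ->; rewrite mpolyX0.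
rewrite mdegE sum_nat_eq0 negb_forall => /existsP[i mi].
rewrite -(@submK _ 'U_(i) m); last by rewrite lep1mP.
rewrite mpolyXD mulrC; apply/PX/IH; apply: leq_trans md.
rewrite -[X in (_ < mdeg X)%N](@submK _ 'U_(i) m) ?lep1mP //.
by rewrite mdegD mdeg1 addn1.
Qed.

(** Passing from [m] to [m + U_(i)] multiplies the factorial weight by [m i + 1], the factor that
    differentiation produces. *)
Lemma apolarMXl i f h : apolar ('X_i * f) h = apolar f (mderiv i h).
Proof.
rewrite (mpolyE f) mulr_sumr !apolar_suml; apply: eq_bigr => m _.
rewrite -scalerAr !apolarZl -mpolyXD !apolarX mcoeff_deriv addmC.
congr (_ * _); rewrite -[X in _ = X * _]mulr_natr -mulrA -natrM; congr (_ * _%:R).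
rewrite (bigD1 i) //= [in RHS](bigD1 i) //= mulnA; congr muln.
  by rewrite mnmDE mnm1E eqxx addn1 factS.
apply: eq_bigr => j /negPf ji; rewrite mnmDE mnm1E eq_sym ji addn0 //.
Qed.

Lemma mderiv_lsubst i (A : 'M[F]_k) f :
  mderiv i (lsubst A f) = \sum_j A j i *: lsubst A (mderiv j f).
Proof.
elim/mpoly_ind_mulX: f => [|c f IH|f g IHf IHg|l f IH].
- rewrite rmorph1 -mpolyC1 mderivC big1 // => j _.
  by rewrite mderivC raddf0 scaler0.
- rewrite linearZ /= mderivZ IH scaler_sumr; apply: eq_bigr => j _.
  by rewrite mderivZ [in RHS]linearZ /= !scalerA mulrC.
- rewrite raddfD /= mderivD IHf IHg -big_split; apply: eq_bigr => j _.
  by rewrite mderivD raddfD /= scalerDr.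
have dX (j l' : 'I_k) : mderiv j ('X_l' : {mpoly F[k]}) = (l' == j)%:R.
  rewrite mderivX mnm1E; case: eqP => [->|]; last by rewrite scale0r.
  by rewrite scale1r -[X in X = _]/('X_[_]) -{1}(add0m 'U_(j)) addmK mpolyX0.
rewrite rmorphM mderivM IH /= lsubstXU.
have -> : mderiv i (\sum_j A l j *: 'X_j) = (A l i)%:A.
  rewrite raddf_sum (bigD1 i) //= big1 ?addr0 => [|j ji].
    by rewrite mderivZ dX eqxx.
  by rewrite mderivZ dX (negPf ji) scaler0.
under [RHS]eq_bigr do rewrite mderivM raddfD /= scalerDr.
rewrite big_split /=; congr (_ + _).
  rewrite [RHS](bigD1 l) //= [X in _ = _ + X]big1 ?addr0 => [|j jl].
    by rewrite dX eqxx mul1r -scalerAl mul1r.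
  by rewrite dX eq_sym (negPf jl) mul0r raddf0 scaler0.
by rewrite mulr_sumr; apply: eq_bigr => j _; rewrite rmorphM /= lsubstXU -scalerAr.
Qed.

Lemma mcoeff0E f : f@_(@mnm0 k) = f.@[fun=> 0].
Proof.
elim/mpoly_ind_mulX: f => [|c f IH|f g IHf IHg|l f IH].
- by rewrite mcoeff1 eqxx meval1.
- by rewrite mcoeffZ mevalZ IH.
- by rewrite mcoeffD mevalD IHf IHg.
by rewrite rmorphM mevalM mevalXU mul0r /= mcoeffX mnm1_eq0 mul0r.
Qed.

(** Induction on [f]: a factor [X_i] becomes the sum of the [A i j *: X_j], whose adjoint is the sum
    of the [A i j] times d/dX_j. By the chain rule for [A^T], this is d/dX_i taken after the
    substitution in [h]. *)
Lemma apolar_lsubst (A : 'M[F]_k) f h :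
  apolar (lsubst A f) h = apolar f (lsubst A^T h).
Proof.
elim/mpoly_ind_mulX: f h => [|c f IH|f g IHf IHg|i f IH] h.
- rewrite rmorph1 -mpolyX0 !apolarX !mcoeff0E meval_lsubst; congr (_ * _).
  by apply: meval_eq => j; rewrite big1 // => l _; rewrite mulr0.
- by rewrite linearZ /= !apolarZl IH.
- by rewrite raddfD /= !apolarDl IHf IHg.
rewrite rmorphM /= lsubstXU mulr_suml apolar_suml apolarMXl mderiv_lsubst.
rewrite apolarC apolar_suml; apply: eq_bigr => j _.
by rewrite -scalerAl !apolarZl apolarMXl IH mxE apolarC.
Qed.

(** The witness is [p(d/dX) h], built one variable at a time. *)
Lemma apolar_mulmx_adjoint p h : exists g, forall f, apolar (p * f) h = apolar f g.
Proof.
elim/mpoly_ind_mulX: p h => [|c p IH|p q IHp IHq|i p IH] h.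
- by exists h => f; rewrite mul1r.
- have [g Hg] := IH h; exists (c *: g) => f.
  by rewrite -scalerAl apolarZl Hg [RHS]apolarC apolarZl apolarC.
- have [g Hg] := IHp h; have [g' Hg'] := IHq h; exists (g + g') => f.
  by rewrite mulrDl apolarDl Hg Hg' [RHS]apolarC apolarDl !(apolarC f).
- have [g Hg] := IH (mderiv i h); exists g => f.
  by rewrite -mulrA apolarMXl Hg.
Qed.

End Apolar.

Section ApolarNumField.

Context {F : numFieldType} {k : nat}.
Implicit Types (f g h p : {mpoly F[k]}).

Lemma prod_fact_neq0 (m : multinom k) : (\prod_i (m i)`!)%:R != 0 :> F.
Proof.
by rewrite pnatr_eq0 -lt0n prodn_gt0 // => i; rewrite fact_gt0.
Qed.

Lemma apolar_nondegenerate f g :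
  (forall h, apolar h f = apolar h g) -> f = g.
Proof.
move=> fg; apply/mpolyP => m; have := fg 'X_[m]; rewrite !apolarX.
exact/mulIf/prod_fact_neq0.
Qed.

(** With real coefficients this bilinear form is a sum of squares with positive weights. *)
Lemma apolar_gt0 f : (forall m, f@_m \is Num.real) -> f != 0 -> 0 < apolar f f.
Proof.
move=> fR f0; have fm_ge0 m : 0 <= f@_m * f@_m by rewrite -expr2 -realEsqr.
rewrite lt0r; apply/andP; split; last first.
  by apply: sumr_ge0 => m _; rewrite mulr_ge0 // ler0n.
apply: contra f0; rewrite /apolar big_seq psumr_eq0; last first.
  by move=> m _; rewrite mulr_ge0 // ler0n.
move=> /allP H; apply/eqP/msuppnil0; case E: (msupp f) => [//|m s].
have mf : m \in msupp f by rewrite E mem_head.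
have := H m mf; rewrite mf /= !mulf_eq0 orbb (negPf (prod_fact_neq0 m)) orbF.
by rewrite mcoeff_eq0 mf.
Qed.

End ApolarNumField.

(** * The generic determinant *)

Lemma sum_mxvec (V : nmodType) m n (f : 'I_(m * n) -> V) :
  \sum_r f r = \sum_k \sum_l f (mxvec_index k l).
Proof.
rewrite (reindex _ (curry_mxvec_bij m n)) pair_bigA /=.
by apply: eq_bigr => -[].
Qed.

Section GenericMatrix.

Context {F : comNzRingType} {N : nat}.
Implicit Types (A B : 'M[F]_N) (p : {mpoly F[N * N]}).

Definition genmx : 'M[{mpoly F[N * N]}]_N := \matrix_(i, j) 'X_(mxvec_index i j).

Definition gendet : {mpoly F[N * N]} := \det genmx.

(* The matrix of the substitution [X := A X] in the entries of [X]. *)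
Definition lmulmx_subst A : 'M[F]_(N * N) := (lin_mulmx A)^T.

Lemma lmulmx_substE A i j k l :
  lmulmx_subst A (mxvec_index i j) (mxvec_index k l) = A i k *+ (j == l).
Proof.
rewrite mxE [lin_mulmx A _ _]mxE /= vec_mx_delta mxvecE mxE (bigD1 k) //= big1.
  by rewrite addr0 mxE eqxx /= mulr_natr eq_sym.
by move=> m /negPf mk; rewrite mxE mk mulr0.
Qed.

Lemma tr_lmulmx_subst A : (lmulmx_subst A)^T = lmulmx_subst A^T.
Proof.
apply/matrixP => r c; case/mxvec_indexP: r => i j; case/mxvec_indexP: c => k l.
by rewrite mxE !lmulmx_substE mxE eq_sym.
Qed.

Lemma map_lmulmx_subst A :
  map_mx (lsubst (lmulmx_subst A)) genmx = map_mx (@mpolyC (N * N) F) A *m genmx.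
Proof.
apply/matrixP => i j; rewrite !mxE lsubstXU.
rewrite sum_mxvec.
apply: eq_bigr => k _; rewrite (bigD1 j) //= big1 => [|l /negPf lj].
  by rewrite lmulmx_substE eqxx addr0 !mxE mul_mpolyC.
by rewrite lmulmx_substE eq_sym lj scale0r.
Qed.

Lemma lsubst_gendet A : lsubst (lmulmx_subst A) gendet = \det A *: gendet.
Proof.
rewrite /gendet -det_map_mx map_lmulmx_subst det_mulmx det_map_mx.
by rewrite mul_mpolyC.
Qed.

Definition eval_mx B p : F := p.@[fun r => mxvec B 0 r].

Lemma map_eval_mx B : map_mx (eval_mx B) genmx = B.
Proof. by apply/matrixP => i j; rewrite !mxE /eval_mx mevalXU mxvecE. Qed.

Lemma eval_gendet B : eval_mx B gendet = \det B.
Proof. by rewrite -{2}(map_eval_mx B) det_map_mx. Qed.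

Lemma eval_lmulmx_subst A B p :
  eval_mx B (lsubst (lmulmx_subst A) p) = eval_mx (A *m B) p.
Proof.
rewrite /eval_mx meval_lsubst; apply: meval_eq => r.
case/mxvec_indexP: r => i j; rewrite mxvecE mxE.
rewrite sum_mxvec.
apply: eq_bigr => k _; rewrite (bigD1 j) //= big1 => [|l /negPf lj].
  by rewrite lmulmx_substE eqxx addr0 mxvecE.
by rewrite lmulmx_substE eq_sym lj mul0r.
Qed.

Lemma gendet_neq0 : gendet != 0.
Proof.
apply/eqP => /(congr1 (eval_mx 1%:M)); rewrite eval_gendet det1 /eval_mx meval0.
by move/eqP; rewrite oner_eq0.
Qed.

End GenericMatrix.

(** * Semi-invariance of powers of the determinant *)

Section SemiInvariance.

Context {F : numFieldType} {N : nat}.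
Implicit Types (A B : 'M[F]_N) (a p : {mpoly F[N * N]}).
Local Notation delta := (gendet : {mpoly F[N * N]}).

Lemma gendet_real k m : (delta ^+ k)@_m \is Num.real.
Proof.
have -> : delta = map_mpoly ( *~%R 1 : int -> F) gendet.
  rewrite /gendet -det_map_mx; congr (\det _).
  by apply/matrixP => i j; rewrite !mxE /= map_mpolyX.
by rewrite -(rmorphXn (map_mpoly ( *~%R 1 : int -> F))) /= mcoeff_map_mpoly realz.
Qed.

Lemma apolar_gendet_gt0 k : 0 < apolar (delta ^+ k) (delta ^+ k).
Proof.
by apply: apolar_gt0; [exact: gendet_real | rewrite expf_neq0 ?gendet_neq0].
Qed.

(** The adjoint of the substitution [X := A X] is [X := A^T X], which only rescales the
    determinant. *)
Lemma apolar_lmulmx_gendet A a k :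
  apolar (lsubst (lmulmx_subst A) a) (delta ^+ k)
  = \det A ^+ k * apolar a (delta ^+ k).
Proof.
rewrite apolar_lsubst tr_lmulmx_subst rmorphXn /= lsubst_gendet exprZn det_tr.
by rewrite apolarZr.
Qed.

(** The value at the identity determines [p] on invertible matrices. An extra factor [delta] makes
    both sides agree at singular matrices as well, and is then cancelled. *)
Lemma semi_invariant_gendet k p :
  (forall A, \det A != 0 -> lsubst (lmulmx_subst A) p = \det A ^+ k *: p) ->
  p = eval_mx 1%:M p *: delta ^+ k.
Proof.
move=> Hp; set c := eval_mx _ _.
have p_eval A : \det A != 0 -> eval_mx A p = \det A ^+ k * c.
  move=> /Hp /(congr1 (eval_mx 1%:M)).
  by rewrite eval_lmulmx_subst mulmx1 /eval_mx mevalZ.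
suff : (p - c *: delta ^+ k) * delta = 0.
  move/eqP; rewrite mulf_eq0 (negPf gendet_neq0) orbF subr_eq0 => /eqP //.
apply: mpoly_eq0_of_meval => v.
have -> : v = (fun r => mxvec (vec_mx (\row_r v r)) 0 r).
  by apply: funext => r; rewrite vec_mxK mxE.
set B := vec_mx _; rewrite mevalM -!/(eval_mx B _) eval_gendet.
have [->|B0] := eqVneq (\det B) 0; first by rewrite mulr0.
rewrite /eval_mx mevalB mevalZ rmorphXn /= -!/(eval_mx B _) eval_gendet p_eval //.
by rewrite mulrC (mulrC c) subrr mulr0.
Qed.

(** A qualitative Cayley identity: [det(d/dX)^j] maps [delta ^+ (k + j)] to a semi-invariant of
    weight [k], hence to a multiple of [delta ^+ k]. *)
Lemma apolar_mul_gendet j k : exists c, forall a,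
  apolar (delta ^+ j * a) (delta ^+ (k + j)) = c * apolar a (delta ^+ k).
Proof.
have [g Hg] := apolar_mulmx_adjoint (delta ^+ j) (delta ^+ (k + j)).
suff gE : g = eval_mx 1%:M g *: delta ^+ k.
  by exists (eval_mx 1%:M g) => a; rewrite Hg {1}gE apolarZr.
apply: semi_invariant_gendet => A A0.
apply: apolar_nondegenerate => a.
rewrite -[A in LHS]trmxK -tr_lmulmx_subst -apolar_lsubst -Hg.
(* This factor turns [delta ^+ j] into its own translate, so that semi-invariance applies to the
   whole product. *)
apply: (@mulfI _ (\det A^T ^+ j)); first by rewrite expf_neq0 ?det_tr.
rewrite -apolarZl scalerAl -exprZn -lsubst_gendet -rmorphXn -rmorphM /=.
rewrite apolar_lmulmx_gendet Hg apolarZr det_tr.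
by rewrite mulrA -exprD addnC.
Qed.

End SemiInvariance.

Lemma lsubst_mmap (F : comNzRingType) k l n (A : 'M[F]_(l, n))
    (x : 'I_k -> {mpoly F[l]}) p :
  lsubst A (mmap (@mpolyC l F) x p)
  = mmap (@mpolyC n F) (fun i => lsubst A (x i)) p.
Proof.
have lsubstM := rmorphM (lsubst A).
have lsubstp (y : 'I_k -> {mpoly F[l]}) m :
    lsubst A (mmap1 y m) = mmap1 (fun i => lsubst A (y i)) m.
  rewrite /mmap1; elim/big_rec2: _ => [|i _ y' _ <-]; first exact: rmorph1.
  by rewrite lsubstM; congr (_ * _); exact: rmorphXn.
pose f m : {mpoly F[l]} := mpolyC l p@_m * mmap1 x m.
have fE : lsubst A (\sum_(m <- msupp p) f m) = \sum_(m <- msupp p) lsubst A (f m).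
  exact: raddf_sum.
rewrite [LHS]fE; apply: eq_bigr => m _; rewrite lsubstM.
by congr (_ * _); [exact: lsubstC | exact: lsubstp].
Qed.

(** * Non-integrality of the generic determinant *)

Section NotIntegral.

Context {F : numFieldType} {N : nat} {k : nat}.
Variable x : 'I_k -> {mpoly F[N * N]}.
Local Notation delta := (gendet : {mpoly F[N * N]}).
Local Notation K := {fraction {mpoly F[N * N]}}.
Local Notation frac := (@tofrac {mpoly F[N * N]}).

Definition subalgebra : set K :=
  [set z | exists p : {mpoly F[k]}, z = frac (mmap (@mpolyC (N * N) F) x p)].

Lemma subalgebra_subring : subring subalgebra.
Proof.
split=> [|_ _ [p ->] [q ->]|_ _ [p ->] [q ->]].
- by exists 1; rewrite !rmorph1.
- by exists (p - q); rewrite !rmorphB.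
- by exists (p * q); rewrite !rmorphM.
Qed.

Hypothesis apolar0 : forall p j, (0 < j)%N ->
  apolar (mmap (@mpolyC (N * N) F) x p) (delta ^+ j) = 0.

(** Otherwise, clearing denominators makes [delta ^+ s.+1] the sum over [i < s] of
    [delta ^+ (s - i) * b i], with [b i] in the algebra. Its pairing with [delta ^+ s.+1] is
    positive, but [apolar_mul_gendet] reduces each term to a multiple of the pairing of [b i] with
    [delta ^+ i.+1], which is 0. *)
Lemma gendet_notin_adjoin :
  ~ adjoin subalgebra (frac delta)^-1 (frac delta).
Proof.
have d0 : frac delta != 0 by rewrite tofrac_eq0 gendet_neq0.
case=> p px dE; set s := size p.
have [a Ha] := boolp.choice px.
pose b i := mmap (@mpolyC (N * N) F) x (a i).
have cancelX (d : K) i : d != 0 -> (i <= s)%N -> d ^+ s * d^-1 ^+ i = d ^+ (s - i).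
  by move=> dN0 si; rewrite exprVn -expfB_cond ?(negPf dN0).
have E : delta ^+ s.+1 = \sum_(i < s) delta ^+ (s - i) * b i.
  apply/eqP; rewrite -tofrac_eq exprSr rmorphM rmorphXn /= {2}dE.
  rewrite horner_coef mulr_sumr; apply/eqP; rewrite [RHS]rmorph_sum /=.
  apply: eq_bigr => i _.
  by rewrite rmorphM rmorphXn /= -/(b i) -Ha mulrCA cancelX 1?ltnW // mulrC.
have := @apolar_gendet_gt0 F N s.+1.
suff -> : apolar (delta ^+ s.+1) (delta ^+ s.+1) = 0 by rewrite ltxx.
rewrite [X in apolar X _]E apolar_suml.
apply: big1 => i _.
have sE : s.+1 = (i.+1 + (s - i))%N by rewrite addSn subnKC // ltnW.
have [c Hc] := @apolar_mul_gendet F N (s - i) i.+1.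
by have := Hc (b i); rewrite -sE apolar0 // mulr0.
Qed.

End NotIntegral.

(** * Coordinates of tuples of cubics *)

(** [bmultinom N 4] is the finite type of monomials of degree at most 3; the coordinates of a cubic
    in lower degrees are 0. *)
Definition coord_index (N r : nat) : finType := ('I_r * bmultinom N 4)%type.

Definition coord_at {N r : nat} (a : 'I_#|coord_index N r|) : coord_index N r :=
  enum_val a.

Lemma sum_coord_at (V : nmodType) N r (f : coord_index N r -> V) :
  \sum_a f (coord_at a) = \sum_c \sum_m f (c, m).
Proof. by rewrite pair_bigA /= -(big_enum_val f) /=; apply: eq_bigr => -[]. Qed.

Section Coordinates.

Context {T : comNzRingType} {N r : nat}.
Local Notation K := #|coord_index N r|.
Implicit Types (u : 'I_r -> {mpoly T[N]}) (A : 'M[T]_N).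

Definition coords u (a : 'I_K) : T := (u (coord_at a).1)@_(coord_at a).2.

Definition coords_mx A : 'M[T]_K := \matrix_(a, b)
  if (coord_at a).1 == (coord_at b).1
  then (lsubst A 'X_[(coord_at b).2])@_(coord_at a).2 else 0.

Lemma coords_lsubst A u a : (forall c, msize (u c) <= 4)%N ->
  coords (fun c => lsubst A (u c)) a = \sum_b coords_mx A a b * coords u b.
Proof.
move=> u4; rewrite /coords.
have -> : lsubst A (u (coord_at a).1) = \sum_(m : bmultinom N 4)
    (u (coord_at a).1)@_m *: lsubst A 'X_[m].
  rewrite {1}(mpolywE (u4 _)) (raddf_sum (lsubst A)).
  by apply: eq_bigr => m _; rewrite /= linearZ.
rewrite (raddf_sum (mcoeff (coord_at a).2)) /=.
under [RHS]eq_bigr do rewrite mxE.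
rewrite (sum_coord_at (fun b : coord_index N r =>
  (if (coord_at a).1 == b.1 then (lsubst A 'X_[b.2])@_(coord_at a).2 else 0)
  * (u b.1)@_b.2)) /=.
rewrite (bigD1 (coord_at a).1) //= [X in _ = _ + X]big1 ?addr0; last first.
  move=> c /negPf ca; apply: big1 => m _.
  by rewrite eq_sym ca mul0r.
by apply: eq_bigr => m _; rewrite eqxx mcoeffZ mulrC.
Qed.

End Coordinates.

(** Moves the generic entries into the coefficients: a polynomial in the coordinates of the
    translate of [v] becomes a polynomial over [{mpoly F[l]}] evaluated at [v]. *)
Lemma meval_map_coords (F : comNzRingType) (k l : nat) (g : 'M[{mpoly F[l]}]_k)
    (v : 'I_k -> F) p :
  mmap (@mpolyC l F) (fun a => \sum_b g a b * mpolyC l (v b)) p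
  = (lsubst g (map_mpoly (@mpolyC l F) p)).@[fun b => mpolyC l (v b)].
Proof.
rewrite meval_lsubst.
apply: (rmorph_mpoly_ext
  (f := mmap (@mpolyC l F) (fun a => \sum_b g a b * mpolyC l (v b)))
  (g := meval (fun a => \sum_b g a b * mpolyC l (v b)) \o map_mpoly (@mpolyC l F)))
  => [c|i] /=.
  by rewrite map_mpolyC mmapC mevalC.
by rewrite map_mpolyX mevalXU mmapX mmap1U.
Qed.

Lemma apolar_meval (F : comNzRingType) k l (Q : {mpoly {mpoly F[l]}[k]})
    (v : 'I_k -> F) h :
  apolar (Q.@[fun b => mpolyC l (v b)]) h
  = (\sum_(m <- msupp Q) apolar Q@_m h *: 'X_[m]).@[v].
Proof.
rewrite mevalE apolar_suml raddf_sum /=; apply: eq_bigr => m _.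
rewrite mevalZ mevalX [in RHS]mulrC -apolarZl -mul_mpolyC mulrC.
congr (apolar (_ * _) h).
by rewrite rmorph_prod; apply: eq_bigr => i _; rewrite rmorphXn.
Qed.

(** * Invariants obtained from the apolar pairing *)

Section OrbitCoordinates.

Context {F : numFieldType} {N r : nat}.
Local Notation K := #|coord_index N r|.
Local Notation delta := (gendet : {mpoly F[N * N]}).
Local Notation C := (@mpolyC (N * N) F).
Implicit Types (u : 'I_r -> {mpoly F[N]}) (A : 'M[F]_N) (p : {mpoly F[K]}).

Definition orbit_coords u : 'I_K -> {mpoly F[N * N]} :=
  coords (fun c => lsubst genmx (map_mpoly C (u c))).

(* By [apolar_lmulmx_gendet], pairing with a power of the determinant turns a
   polynomial in the coordinates of [X . u] into an invariant of [u]. *)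
Definition reynolds p k u : F := apolar (mmap C (orbit_coords u) p) (delta ^+ k).

(** Translating [u] by [A] amounts to substituting [A *m X] for the generic matrix [X] in the orbit
    coordinates, which multiplies the pairing by [\det A ^+ k]. *)
Lemma reynolds_invariant p k A u : \det A = 1 ->
  reynolds p k (fun c => lsubst A (u c)) = reynolds p k u.
Proof.
move=> dA; rewrite /reynolds.
pose th := lsubst (lmulmx_subst A).
have mapth (p' : {mpoly F[N]}) : map_mpoly th (map_mpoly C p') = map_mpoly C p'.
  apply/mpolyP => m; rewrite [LHS]mcoeff_map_mpoly [in LHS]mcoeff_map_mpoly.
  by rewrite [RHS]mcoeff_map_mpoly [LHS]lsubstC.
have orbitE c : lsubst genmx (map_mpoly C (lsubst A (u c)))
    = map_mpoly th (lsubst genmx (map_mpoly C (u c))).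
  by rewrite (map_lsubst th) mapth map_lmulmx_subst -lsubst_comp (map_lsubst C).
have coordsE a : orbit_coords (fun c => lsubst A (u c)) a = th (orbit_coords u a).
  by rewrite [LHS]/orbit_coords [LHS]/coords orbitE [LHS]mcoeff_map_mpoly.
rewrite (_ : orbit_coords _ = fun a => lsubst (lmulmx_subst A) (orbit_coords u a)).
  rewrite -lsubst_mmap.
  have := apolar_lmulmx_gendet A (mmap C (orbit_coords u) p) k.
  by rewrite dA expr1n mul1r.
by apply: funext => a; apply: coordsE.
Qed.

(** The orbit coordinates are linear in those of [u], so [p] becomes a form of degree [d] in [u]
    whose coefficients are polynomials in [X]; pairing each coefficient with [delta ^+ k] leaves
    scalars. *)
Lemma reynolds_homog p k d : p \is homogeneous d ->
  exists2 Q : {mpoly F[K]}, Q \is homogeneous d &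
  forall u, (forall c, msize (u c) <= 4)%N -> reynolds p k u = Q.@[coords u].
Proof.
move=> pd; pose Q0 := lsubst (coords_mx genmx) (map_mpoly C p).
have Q0d : Q0 \is homogeneous d.
  apply: lsubst_homog; apply/dhomogP => m.
  rewrite mcoeff_msupp mcoeff_map_mpoly mpolyC_eq0 -mcoeff_msupp.
  by move/dhomogP: pd; apply.
exists (\sum_(m <- msupp Q0) apolar Q0@_m (delta ^+ k) *: 'X_[m]).
  rewrite big_seq; apply: rpred_sum => m mQ; apply: rpredZ.
  by rewrite dhomogX /=; move/dhomogP: Q0d => /(_ m mQ) ->.
move=> u u4; rewrite -apolar_meval -meval_map_coords /reynolds.
congr (apolar (mmap _ _ p) _); apply: funext => a.
rewrite /orbit_coords coords_lsubst => [|c].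
  by apply: eq_bigr => b _; rewrite /coords mcoeff_map_mpoly.
rewrite msizeE; apply/bigmax_leqP_seq => m; rewrite mcoeff_msupp mcoeff_map_mpoly.
rewrite mpolyC_eq0 -mcoeff_msupp => /msize_mdeg_lt mu _.
exact: leq_trans mu (u4 c).
Qed.

End OrbitCoordinates.

(** * The chain of monomials *)

Section ChainForm.

Context {N : nat}.
Implicit Types (a b j : 'I_N).

Lemma chain_next_subproof a :
  ((if a.*2 < N then N.-1 - a else N - a) < N)%N.
Proof. by have := ltn_ord a; case: ifP; lia. Qed.

(* Starting at 0, [chain_next] runs through 0, N-1, 1, N-2, ... and fixes the
   last variable. *)
Definition chain_next a : 'I_N := Ordinal (chain_next_subproof a).

Definition chain_mnm a : multinom N :=
  mnm_add (mnm_add 'U_(a) 'U_(a)) 'U_(chain_next a).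

Definition chain_copy a : 'I_4 := inord (N <= a.*2).

(** The weights [w] parametrize the span of the chain monomials, on which the diagonal torus acts by
    characters. *)
Definition chain_form {T : comNzRingType} (w : 'I_N -> T) (c : 'I_4) :
    {mpoly T[N]} :=
  \sum_(a | chain_copy a == c) w a *: 'X_[chain_mnm a].

Lemma mdeg_chain_mnm a : mdeg (chain_mnm a) = 3.
Proof. by rewrite !mdegD !mdeg1. Qed.

Lemma chain_copy_eq a b :
  (chain_copy a == chain_copy b) = ((N <= a.*2) == (N <= b.*2))%N.
Proof.
have lt4 (x : bool) : (x < 4)%N by case: x.
by rewrite -val_eqE /= !inordK //; case: (N <= _)%N; case: (N <= _)%N.
Qed.

(** The hypotheses compare the exponents of [x_a] and [x_b] in an equality
    [x_i x_j x_k = x_a^2 x_b], where [a = b] may occur. *)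
Lemma two_of_three (i j k a b : nat) :
  ((i == a) + (j == a) + (k == a) = 1 + 1 + (b == a))%N ->
  ((i == b) + (j == b) + (k == b) = (a == b) + (a == b) + 1)%N ->
  [\/ [/\ i = a, j = a & k = b], [/\ i = a, j = b & k = a]
     | [/\ i = b, j = a & k = a]].
Proof.
case: (i =P a) => [->|ia]; case: (j =P a) => [->|ja]; case: (k =P a) => [->|ka];
  case: (b =P a) => [->|ba] //= _; rewrite ?eqxx /=.
all: try by constructor 1.
all: case: (a =P b) => [ab|_]; rewrite ?addn0 //=; try by case: ba.
all: try by move/eqP: ia => /negPf ->.
all: try (by case: eqP => [->|] // _; constructor).
Qed.

(* Within one copy the monomials form an antichain for the order induced by
   lowering the indices of variables. *)
Lemma chain_antichain a b j1 j2 j3 :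
  chain_copy a = chain_copy b -> (j1 <= b)%N -> (j2 <= b)%N ->
  (j3 <= chain_next b)%N ->
  mnm_add (mnm_add 'U_(j1) 'U_(j2)) 'U_(j3) = chain_mnm a ->
  [/\ b = a, j1 = a, j2 = a & j3 = chain_next a].
Proof.
move=> /eqP; rewrite chain_copy_eq => ab j1b j2b j3b E.
have tE : chain_next a = (if a.*2 < N then N.-1 - a else N - a)%N :> nat by [].
have tbE : chain_next b = (if b.*2 < N then N.-1 - b else N - b)%N :> nat by [].
move: E tE; rewrite /chain_mnm; move: (chain_next a) => t E tE.
have E1 := congr1 (fun m : multinom N => m a) E.
have {E} E2 := congr1 (fun m : multinom N => m t) E.
move: E1 E2; rewrite !mnmDE !mnm1E !eqxx -!val_eqE => E1 E2.
have {E1 E2} H := two_of_three E1 E2.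
suff [? ? ? ?] : [/\ b = a :> nat, j1 = a :> nat, j2 = a :> nat & j3 = t :> nat].
  by split; apply: val_inj.
move: (ltn_ord a) (ltn_ord b) => aN bN.
(* One of [j1], [j2] is [a], so [a <= b]. As [chain_next] is strictly decreasing on each half, the
   bounds on the other factors force equality. *)
have bE : b = a :> nat.
  move: ab tE tbE j3b.
  by case: (ltnP a.*2 N) => a2; case: (ltnP b.*2 N) => b2 //= _ tE tbE j3b;
    case: H => -[h1 h2 h3]; simpl in h1, h2, h3; lia.
move: tE tbE j3b; rewrite bE.
by case: (ltnP a.*2 N) => a2 tE tbE j3b;
  case: H => -[h1 h2 h3]; simpl in h1, h2, h3; split; lia.
Qed.

Lemma sum3_single (V : nmodType) (f : 'I_N -> 'I_N -> 'I_N -> V) a b c :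
  (forall i j k, [&& i == a, j == b & k == c] = false -> f i j k = 0) ->
  \sum_i \sum_j \sum_k f i j k = f a b c.
Proof.
move=> f0; rewrite (bigD1 a) //= [X in _ + X]big1 ?addr0 => [|i ia]; last first.
  by apply: big1 => j _; apply: big1 => k _; apply: f0; rewrite (negPf ia).
rewrite (bigD1 b) //= [X in _ + X]big1 ?addr0 => [|j jb]; last first.
  by apply: big1 => k _; apply: f0; rewrite (negPf jb) andbF.
rewrite (bigD1 c) //= [X in _ + X]big1 ?addr0 // => k kc.
by apply: f0; rewrite (negPf kc) !andbF.
Qed.

(** Triangularity keeps only the terms of the expansion whose indices are lowered from those of
    [chain_mnm b]; by [chain_antichain], at most one of them has the monomial [chain_mnm a]. *)
Lemma mcoeff_lsubst_chain (T : comNzRingType) (A : 'M[T]_N) a b :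
  is_trig_mx A -> chain_copy b = chain_copy a ->
  (lsubst A 'X_[chain_mnm b])@_(chain_mnm a)
  = if b == a then A a a ^+ 2 * A (chain_next a) (chain_next a) else 0.
Proof.
move=> /is_trig_mxP A0 ba; rewrite !mpolyXD !rmorphM /= !lsubstXU.
pose f j1 j2 j3 : T := A b j1 * A b j2 * A (chain_next b) j3
  * (mnm_add (mnm_add 'U_(j1) 'U_(j2)) 'U_(j3) == chain_mnm a)%:R.
transitivity (\sum_j1 \sum_j2 \sum_j3 f j1 j2 j3).
  rewrite big_distrlr /= mulr_suml raddf_sum /=; apply: eq_bigr => j1 _.
  rewrite mulr_suml raddf_sum /=; apply: eq_bigr => j2 _.
  rewrite mulr_sumr raddf_sum /=; apply: eq_bigr => j3 _.
  rewrite -!(scalerAl, scalerAr) -!mpolyXD !mcoeffZ mcoeffX /f.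
  by rewrite -!mulrA [LHS]mulrCA; congr (_ * _); rewrite [LHS]mulrCA.
have f0 j1 j2 j3 : f j1 j2 j3 != 0 ->
    [/\ b = a, j1 = a, j2 = a & j3 = chain_next a].
  rewrite /f; case: (mnm_add _ _ =P _) => [E|]; last by rewrite mulr0 eqxx.
  rewrite mulr1 => fN0; apply: chain_antichain (esym ba) _ _ _ E.
  - by rewrite leqNgt; apply: contraNN fN0 => /A0 ->; rewrite !mul0r.
  - by rewrite leqNgt; apply: contraNN fN0 => /A0 ->; rewrite mulr0 mul0r.
  - by rewrite leqNgt; apply: contraNN fN0 => /A0 ->; rewrite mulr0.
rewrite (sum3_single (a := a) (b := a) (c := chain_next a)); last first.
  move=> j1 j2 j3 jN; apply/eqP; apply: contraFT jN => /f0[_ -> -> ->].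
  by rewrite !eqxx.
have [ba'|bNa] := eqVneq b a; first by rewrite /f ba' eqxx mulr1 expr2.
by apply/eqP; apply: contraNT bNa => /f0[-> _ _ _].
Qed.

Lemma mcoeff_lsubst_chain_form (T : comNzRingType) (A : 'M[T]_N) a :
  is_trig_mx A ->
  (lsubst A (chain_form (fun=> 1) (chain_copy a)))@_(chain_mnm a)
  = A a a ^+ 2 * A (chain_next a) (chain_next a).
Proof.
move=> At; rewrite /chain_form (raddf_sum (lsubst A)) (raddf_sum (mcoeff _)) /=.
rewrite (bigD1 a) //= big1 => [|b /andP[/eqP ba bNa]].
  by rewrite scale1r addr0 mcoeff_lsubst_chain // eqxx.
by rewrite scale1r mcoeff_lsubst_chain // (negPf bNa).
Qed.

End ChainForm.

(* [chain_pos M 0], ..., [chain_pos M M] are 0, M, 1, M-1, 2, ... *)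
Definition chain_pos M (i : nat) : 'I_M.+1 :=
  inord (if odd i then M - i./2 else i./2)%N.

Section ChainPos.

Context {M : nat}.
Local Notation pos := (chain_pos M).

Lemma chain_posE i : (i < M.+1)%N ->
  pos i = (if odd i then M - i./2 else i./2)%N :> nat.
Proof. by move=> iM; rewrite inordK //; case: ifP => _; lia. Qed.

Lemma chain_pos_inj : injective (fun i : 'I_M.+1 => pos i).
Proof.
move=> i j /(congr1 val); rewrite /= !chain_posE // => ij; apply: val_inj => /=.
have := odd_double_half i; have := odd_double_half j.
have := ltn_ord i; have := ltn_ord j.
by move: ij; case: (odd i); case: (odd j); lia.
Qed.

Lemma chain_next_pos i : (i < M)%N -> chain_next (pos i) = pos i.+1.
Proof.
move=> iM; apply: val_inj; rewrite /= !chain_posE //; last by rewrite ltnW.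
have := odd_double_half i; rewrite /= uphalf_half.
by case: (odd i) => /= Hi; case: ifP; lia.
Qed.

Lemma chain_next_last : chain_next (pos M) = pos M.
Proof.
apply: val_inj; rewrite /= !chain_posE //.
have := odd_double_half M.
by case: (odd M) => /= Hi; case: ifP; lia.
Qed.

(** The torus weight of the monomial with exponents [e] in the coefficients of the chain
    monomials. *)
Definition chain_weight (e : multinom M.+1) b : nat := \sum_a e a * chain_mnm a b.

Lemma sum_chain_weight e : (\sum_b chain_weight e b = 3 * mdeg e)%N.
Proof.
rewrite exchange_big /= mdegE big_distrr /=; apply: eq_bigr => a _.
by rewrite -big_distrr /= -mdegE mdeg_chain_mnm mulnC.
Qed.

(** Each variable is squared in its own monomial and occurs once in the preceding one. The last
    variable, its own successor, is excluded by [i < M]. *)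
Lemma chain_weight_pos e i : (i < M)%N ->
  chain_weight e (pos i) = (2 * e (pos i) + (if i is j.+1 then e (pos j) else 0))%N.
Proof.
move=> iM.
have -> : chain_weight e (pos i)
    = (\sum_a e a * (2 * (a == pos i)) + \sum_a e a * (chain_next a == pos i))%N.
  rewrite -big_split /=; apply: eq_bigr => a _.
  by rewrite -mulnDr !mnmDE !mnm1E addnn -mul2n.
congr addn.
  rewrite (bigD1 (pos i)) //= eqxx big1 ?addn0 ?muln1 1?mulnC // => a /negPf ->.
  by rewrite !muln0.
rewrite (reindex_inj chain_pos_inj) /=.
have posI (j : 'I_M.+1) : (chain_next (pos j) == pos i) = (j.+1 == i :> nat).
  have eq_pos k : (k < M.+1)%N -> (pos k == pos i) = (k == i).
    move=> kM; apply/eqP/eqP => [|-> //] ki.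
    have iM' : (i < M.+1)%N by rewrite ltnW.
    by have [] := @chain_pos_inj (Ordinal kM) (Ordinal iM') ki.
  have := ltn_ord j; rewrite ltnS leq_eqVlt => /orP[/eqP jM|jM].
    by rewrite jM chain_next_last eq_pos //; lia.
  by rewrite chain_next_pos // eq_pos.
under eq_bigr do rewrite posI.
case: i iM posI => [|i] iM _; first by apply: big1 => j _; rewrite muln0.
have iM' : (i < M.+1)%N by lia.
rewrite (bigD1 (Ordinal iM')) //= eqxx muln1 big1 ?addn0 // => j.
by rewrite -val_eqE /= eqSS => /negPf ->; rewrite muln0.
Qed.

(** The induction keeps [k = 2^(i+1) c] and [e_i = c J] with [J] odd. Then
    [2 e_(i+1) = c (2^(i+1) - J)], where the second factor is odd, so [c] is even and one more power
    of 2 splits off [k]. *)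
Lemma chain_weight_dvd e k : (0 < k)%N -> (forall b, chain_weight e b = k) ->
  (2 ^ M %| k)%N.
Proof.
move=> k0 ek.
suff H i : (i < M)%N -> exists c J, [/\ k = 2 ^ i.+1 * c, e (pos i) = c * J & odd J]%N.
  case: (posnP M) => [->|M0]; first by rewrite dvd1n.
  have [|c [J [kE _ _]]] := H M.-1; first by rewrite prednK.
  by rewrite kE prednK // dvdn_mulr.
elim: i => [M0|i IH iM].
  have := ek (pos 0); rewrite chain_weight_pos // addn0 => ke.
  by exists (e (pos 0)), 1%N; split; rewrite ?muln1.
have [|c [J [kE eE Jodd]]] := IH; first exact: ltnW.
have := ek (pos i.+1); rewrite chain_weight_pos // eE => ke.
have c0 : (0 < c)%N by move: k0; rewrite kE muln_gt0 => /andP[].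
(* Keeps the subtraction [2 ^ i.+1 - J] from truncating. *)
have JP : (J <= 2 ^ i.+1)%N.
  by rewrite -(leq_pmul2l c0) (mulnC c (2 ^ _)%N) -kE -ke leq_addl.
have odd_JP : odd (2 ^ i.+1 - J) by rewrite oddB // Jodd oddX.
have E : (2 * e (pos i.+1) = c * (2 ^ i.+1 - J))%N.
  by rewrite mulnBr (mulnC c (2 ^ _)%N) -kE -ke addnK.
have c2 : (2 %| c)%N.
  have : (2 %| c * (2 ^ i.+1 - J))%N by rewrite -E dvdn_mulr.
  by rewrite Gauss_dvdl // coprime2n.
exists (c %/ 2)%N, (2 ^ i.+1 - J)%N; split=> //.
  by rewrite expnSr -mulnA (mulnC 2) divnK.
apply/eqP; rewrite -(eqn_pmul2l (m := 2)) // E mulnA (mulnC 2) divnK //.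
Qed.

End ChainPos.

(** * Non-nullity *)

Lemma mcoeff_lsubst_subring (K : fieldType) (O : set K) k l
    (B : 'M[K]_(k, l)) m m' :
  subring O -> (forall i j, O (B i j)) -> O (lsubst B 'X_[m])@_m'.
Proof.
move=> Or OB; pose P (p : {mpoly K[l]}) := forall m, O p@_m.
have [O1 _ OM] := Or; have O0 := subring0 Or.
have PM p q : P p -> P q -> P (p * q).
  move=> Pp Pq m0; rewrite mcoeffM; apply: subring_sum => // i _.
  by apply: OM.
have P1 : P 1 by move=> m0; rewrite mcoeff1; case: eqP.
suff : P (lsubst B 'X_[m]) by apply.
rewrite lsubstX; elim/big_ind: _ => // i _.
elim: (m i) => [|e IH]; rewrite ?expr0 // exprS; apply: PM => //.
move=> m0; rewrite raddf_sum /=; apply: subring_sum => // j _.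
by rewrite mcoeffZ mcoeffX; apply: OM => //; case: eqP.
Qed.

Section ChainValuation.

Context {K : fieldType} {O : set K}.
Hypothesis Or : subring O.

(** Exponents are balanced along the chain: the entries before [t m] share the exponent [k], while
    [t m] has some [r <= k], which the next relation completes. *)
Lemma chain_product (t : nat -> K) M :
  (forall i, (i < M)%N -> O (t i ^+ 2 * t i.+1)) -> O (t M ^+ 3) ->
  exists2 k, (0 < k)%N & O ((\prod_(i < M.+1) t i) ^+ k).
Proof.
have [O1 _ OM] := Or => Ot OtM.
have step m : (m <= M)%N -> exists k r,
    [/\ (0 < k)%N, (r <= k)%N & O ((\prod_(i < m) t i) ^+ k * t m ^+ r)].
  elim: m => [_|m IH /[dup] mM /ltnW /IH [k [r [k0 rk Okr]]]].
    by exists 1%N, 0%N; split; rewrite // big_ord0 !expr1n mulr1.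
  (* Squaring and multiplying by [(t m ^+ 2 * t m.+1) ^+ (k - r)] gives [t m] the exponent
     [2 r + 2 (k - r) = 2 k] and [t m.+1] the exponent [k - r]. *)
  exists (k * 2)%N, (k - r)%N; split; [by rewrite muln_gt0 k0| |].
    by rewrite (leq_trans (leq_subr _ _)) // leq_pmulr.
  have := OM _ _ (subringX 2 Or Okr) (subringX (k - r) Or (Ot m mM)).
  rewrite big_ord_recr /= !exprMn -!exprM.
  have -> : (k * 2 = r * 2 + 2 * (k - r))%N by lia.
  set x := \prod_(i < m) _; rewrite !exprD.
  by congr (O _); ring.
have [k [r [k0 rk Okr]]] := step M (leqnn M).
exists (k * 3)%N; first by rewrite muln_gt0 k0.
have := OM _ _ (subringX 3 Or Okr) (subringX (k - r) Or OtM).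
rewrite big_ord_recr /= !exprMn -!exprM.
have -> : (k * 3 = r * 3 + 3 * (k - r))%N by lia.
set x := \prod_(i < M) _; rewrite !exprD.
by congr (O _); ring.
Qed.

Lemma chain_det N (A : 'M[K]_N) : is_trig_mx A ->
  (forall a, O (A a a ^+ 2 * A (chain_next a) (chain_next a))) ->
  exists2 k, (0 < k)%N & O (\det A ^+ k).
Proof.
case: N A => [|M] A At OA.
  by exists 1%N; rewrite // expr1 det_mx00; case: Or.
rewrite (det_trig At) (reindex_inj chain_pos_inj) /=.
apply: (@chain_product (fun i => A (chain_pos M i) (chain_pos M i)) M).
  by move=> i iM; rewrite -chain_next_pos.
by have := OA (chain_pos M M); rewrite chain_next_last -exprSr.
Qed.

End ChainValuation.

Lemma chain_form_homog (T : comNzRingType) N (w : 'I_N -> T) c :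
  chain_form w c \is homogeneous 3.
Proof.
by apply: rpred_sum => a _; apply: rpredZ; rewrite dhomogX /= mdeg_chain_mnm.
Qed.

Lemma map_chain_form (S T : comNzRingType) (f : {rmorphism S -> T}) N c :
  map_mpoly f (chain_form (fun _ : 'I_N => 1) c) = chain_form (fun=> 1) c.
Proof.
rewrite /chain_form (raddf_sum (map_mpoly f)) /=; apply: eq_bigr => a _.
by rewrite !scale1r map_mpolyX.
Qed.

Lemma homog_msize (T : comNzRingType) N d (p : {mpoly T[N]}) :
  p \is homogeneous d -> (msize p <= d.+1)%N.
Proof.
by move=> /dhomogP pd; rewrite msizeE; apply/bigmax_leqP_seq => m /pd ->.
Qed.

Lemma chain_reynolds_neq0 (F : numFieldType) N :
  ~ forall p k, (0 < k)%N ->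
    reynolds p k (chain_form (fun _ : 'I_N => 1 : F)) = 0.
Proof.
move=> null; pose q : 'I_4 -> {mpoly F[N]} := chain_form (fun=> 1).
pose frac := @tofrac {mpoly F[N * N]}.
pose delta : {fraction {mpoly F[N * N]}} := frac gendet.
pose A := subalgebra (orbit_coords q).
have Ar : subring A by exact: subalgebra_subring.
have d0 : delta != 0 by rewrite tofrac_eq0 gendet_neq0.
have dA : ~ adjoin A delta^-1 delta by exact: gendet_notin_adjoin.
(* Applied to [A[delta^-1]] rather than [A], so that [O] contains [delta^-1]. *)
have [O [Or AO dO Ov]] := valuation_ring_exists (adjoin_subring _ Ar) d0
  (mem_adjoin _ Ar) dA.
have [B [OB B1 tB]] := trigonalize Or Ov (map_mx frac genmx).
have qK c : map_mpoly frac (map_mpoly (@mpolyC (N * N) F) (q c))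
    = chain_form (fun=> 1) c.
  by rewrite /q !map_chain_form.
pose u c := map_mpoly frac (lsubst genmx (map_mpoly (@mpolyC (N * N) F) (q c))).
have uE c : u c = lsubst (map_mx frac genmx) (chain_form (fun=> 1) c).
  by rewrite /u map_lsubst qK.
have u4 c : (msize (u c) <= 4)%N.
  by rewrite uE; apply/homog_msize/lsubst_homog/chain_form_homog.
have Ou b : O (coords u b).
  apply/AO/sub_adjoin => //; exists 'X_b.
  by rewrite mmapX mmap1U /orbit_coords /coords mcoeff_map_mpoly.
(* The entries of [B] lie in [O], so the coordinates stay in [O] when the generic matrix is replaced
   by its triangular form. *)
have OBu b : O (coords (fun c => lsubst B (u c)) b).
  rewrite coords_lsubst //; apply: subring_sum => // b' _.
  case: (Or) => _ _ OM; apply: OM => //; rewrite mxE; case: ifP => _.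
    exact: mcoeff_lsubst_subring.
  exact: subring0.
have [a|k k0 Odet] := chain_det Or tB.
  have a4 : (mdeg (chain_mnm a) < 4)%N by rewrite mdeg_chain_mnm.
  have := OBu (enum_rank (chain_copy a, BMultinom a4)).
  rewrite /coords /coord_at enum_rankK /= uE lsubst_comp.
  by rewrite mcoeff_lsubst_chain_form.
(* [\det B] is 1 only up to sign, hence the even exponent. *)
have Od : O (delta ^+ (k * 2)).
  have := subringX 2 Or Odet; rewrite -exprM (mulnC k) exprM det_mulmx.
  rewrite [X in O (X ^+ k)]exprMn B1 mulr1.
  by rewrite det_map_mx -exprM.
have [_ _ OM] := Or; have Odv : O delta^-1 by apply/AO/mem_adjoin.
apply: dO; have := OM _ _ Od (subringX (k * 2).-1 Or Odv).
have {1}-> : (k * 2 = (k * 2).-1.+1)%N by lia.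
by rewrite exprS -mulrA -exprMn divff // expr1n mulr1.
Qed.

(** * Low degrees *)

Lemma meval_scale_homog (F : comNzRingType) k d (p : {mpoly F[k]}) c v :
  p \is homogeneous d -> p.@[fun i => c * v i] = c ^+ d * p.@[v].
Proof.
move=> /dhomogP pd; rewrite !mevalE mulr_sumr big_seq [RHS]big_seq.
apply: eq_bigr => m /pd /= <-; rewrite [RHS]mulrCA; congr (_ * _).
rewrite mdegE expr_sum -big_split /=; apply: eq_bigr => i _.
by rewrite exprMn.
Qed.

(** * Comparison of [sigma] and [beta] *)

Section BetaSigma.

Context {R : realType} {U : lmodType R[i]} {G : Type}.
Variable act : G -> U -> U.

Lemma homogeneous_function_scale d (f : U -> R[i]) c u :
  homogeneous_function d f -> f (c *: u) = c ^+ d * f u.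
Proof.
case=> k [l [p [pd fE]]]; rewrite !fE -meval_scale_homog //.
by apply: meval_eq => j; rewrite linearZ.
Qed.

(** At a common zero of the invariants of degrees 1 to [D], every generator takes its value at 0: it
    is constant in degree 0 and vanishes in positive degree. Hence [f u = f 0 = 0]. *)
Lemma generated_null_cone D :
  invariants_generated_up_to act D -> null_cone act = zero_set_up_to act D.
Proof.
move=> gen; apply/seteqP; split=> u /= u0 d f.
  by move=> /andP[d0 _]; apply: u0.
move=> d0 [fh finv].
have [k [l [p [_ fE]]]] := fh.
have fpoly : polynomial_function f by exists k, l, p.
have [k' [h [q [hinv qE]]]] := gen f fpoly finv.
have f0 : f 0 = 0.
  rewrite -(scale0r 0) (homogeneous_function_scale _ _ fh).
  by rewrite expr0n gtn_eqF // mul0r.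
rewrite -f0 !qE; apply: meval_eq => j.
have [e eD he] := hinv j; have [hh _] := he.
have h0 := homogeneous_function_scale 0 u hh.
rewrite scale0r in h0; rewrite h0.
have [e0|e0] := posnP e; first by rewrite e0 expr0 mul1r.
by rewrite (u0 e) ?e0 // mulr0.
Qed.

Lemma sigma_le_beta : (sigma act <= beta act)%E.
Proof.
apply: ereal_inf_le_tmp => _ [D genD <-].
by exists D => //; apply: generated_null_cone.
Qed.

End BetaSigma.

Section LowDegree.

Context {F : numFieldType} {N : nat}.
Implicit Types (t w : 'I_N -> F).

Definition chain_char t a : F := t a ^+ 2 * t (chain_next a).

Lemma chain_charE t a : chain_char t a = \prod_b t b ^+ chain_mnm a b.
Proof.
have tU b : \prod_i t i ^+ mnm1 b i = t b.
  rewrite (bigD1 b) //= mnm1E eqxx big1 ?mulr1 // => i /negPf ib.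
  by rewrite mnm1E eq_sym ib.
rewrite /chain_char /chain_mnm expr2 -!tU -!big_split /=; apply: eq_bigr => i _.
by rewrite !mnmDE !exprD.
Qed.

Lemma lsubst_diag (T : comNzRingType) k (t : 'I_k -> T) m :
  lsubst (diag_mx (\row_i t i)) 'X_[m] = (\prod_i t i ^+ m i) *: 'X_[m].
Proof.
rewrite lsubstX mpolyXE_id -mul_mpolyC rmorph_prod -big_split /=.
apply: eq_bigr => i _; rewrite (bigD1 i) //= big1 => [|j /negPf ji].
  by rewrite addr0 !mxE eqxx mulr1n -mul_mpolyC exprMn rmorphXn.
by rewrite mxE eq_sym ji mulr0n scale0r.
Qed.

Lemma lsubst_diag_chain t w c :
  lsubst (diag_mx (\row_i t i)) (chain_form w c)
  = chain_form (fun a => w a * chain_char t a) c.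
Proof.
rewrite /chain_form (raddf_sum (lsubst _)); apply: eq_bigr => a _ /=.
by rewrite linearZ /= lsubst_diag scalerA chain_charE.
Qed.

End LowDegree.

Section LowDegreeVanishing.

Context {F : numFieldType} {M : nat}.
Implicit Types (t w : 'I_M.+1 -> F).

Lemma prod_chain_char t (e : multinom M.+1) :
  \prod_a chain_char t a ^+ e a = \prod_b t b ^+ chain_weight e b.
Proof.
under eq_bigr do rewrite chain_charE -prodrXl.
rewrite exchange_big /=; apply: eq_bigr => b _.
by rewrite expr_sum; apply: eq_bigr => a _; rewrite -exprM mulnC.
Qed.

(** Each monomial of [g] is itself torus invariant, which forces all [chain_weight e b] to equal one
    number [k]. Then [2 ^ M] divides [k], and summing the weights gives [3 * mdeg e = M.+1 * k]. *)
Lemma torus_invariant_degreeS (g : {mpoly F[M.+1]}) e :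
  (forall t w, \prod_i t i = 1 -> g.@[fun a => w a * chain_char t a] = g.@[w]) ->
  e \in msupp g -> (0 < mdeg e)%N -> (M.+1 * 2 ^ M <= 3 * mdeg e)%N.
Proof.
move=> ginv eg e0.
have te t : \prod_i t i = 1 -> \prod_b t b ^+ chain_weight e b = 1.
  move=> t1; pose L := diag_mx (\row_a chain_char t a).
  have gL : lsubst L g = g.
    apply/eqP; rewrite -subr_eq0; apply/eqP; apply: mpoly_eq0_of_meval => w.
    rewrite mevalB meval_lsubst -[X in _ - X](ginv t w t1); apply/eqP.
    rewrite subr_eq0; apply/eqP; apply: meval_eq => a.
    rewrite (bigD1 a) //= big1 => [|b /negPf ba].
      by rewrite addr0 !mxE eqxx mulr1n mulrC.
    by rewrite mxE eq_sym ba mulr0n mul0r.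
  have := congr1 (mcoeff e) gL.
  rewrite {1}(mpolyE g) (raddf_sum (lsubst L)) (raddf_sum (mcoeff e)) /=.
  rewrite (bigD1_seq e) ?msupp_uniq //= big1 => [|m /negPf me].
    rewrite addr0 linearZ /= lsubst_diag !mcoeffZ mcoeffX eqxx mulr1.
    rewrite prod_chain_char -[RHS]mulr1 => /mulfI; apply.
    by rewrite -mcoeff_msupp.
  by rewrite linearZ /= lsubst_diag !mcoeffZ mcoeffX me !mulr0.
have we a b : chain_weight e a = chain_weight e b.
  have [->//|ab] := eqVneq a b.
  (* The inverse values at [a] and [b] keep the product equal to 1, and powers of 2 determine their
     exponents. *)
  pose t i : F := if i == a then 2 else if i == b then 2^-1 else 1.
  have prodt (k : 'I_M.+1 -> nat) : \prod_i t i ^+ k i = 2 ^+ k a * 2^-1 ^+ k b.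
    rewrite (bigD1 a) //= (bigD1 b) /=; last by rewrite eq_sym.
    rewrite /t eqxx eq_sym (negPf ab) eqxx big1 ?mulr1 // => i.
    by move=> /andP[/negPf-> /negPf->]; rewrite expr1n.
  have two0 : (2 : F) != 0 by rewrite pnatr_eq0.
  have t1 : \prod_i t i = 1.
    have := prodt (fun=> 1%N); under eq_bigr do rewrite expr1.
    by rewrite !expr1 divff.
  have := te t t1; rewrite prodt exprVn => /(canRL (mulfVK _)).
  rewrite expf_neq0 // mul1r => /(_ isT) /eqP.
  rewrite -!natrX eqr_nat eqn_exp2l // => /eqP; exact.
have k0 : (0 < chain_weight e ord0)%N.
  have := sum_chain_weight e; case: posnP => // w0.
  rewrite big1 => [|b _]; last by rewrite (we b ord0).
  by move=> /esym/eqP; rewrite muln_eq0 /= -leqn0 leqNgt e0.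
have /dvdn_leq -/(_ k0) := chain_weight_dvd k0 (fun b => we b ord0).
rewrite -sum_chain_weight; under eq_bigr do rewrite (we _ ord0).
by rewrite sum_nat_const card_ord leq_mul2l.
Qed.

End LowDegreeVanishing.

Lemma torus_invariant_degree (F : numFieldType) N (g : {mpoly F[N]}) e :
  (0 < N)%N ->
  (forall t w, \prod_i t i = 1 -> g.@[fun a => w a * chain_char t a] = g.@[w]) ->
  e \in msupp g -> (0 < mdeg e)%N -> (N * 2 ^ N.-1 <= 3 * mdeg e)%N.
Proof. by case: N g e => // M g e _; apply: torus_invariant_degreeS. Qed.

(** * The action of SL(V) *)

Section CubicsAction.

Context {F : numFieldType} (V : vectType F).
Local Notation N := (\dim {:V}).
Local Notation U := {ffun 'I_4 -> Sym V 3}.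
Implicit Types (u : U) (g : SL V).

Definition cubics u c : {mpoly F[N]} := val (u c).

Definition matrix_of (g : 'End(V)) : 'M[F]_N :=
  passmx.mxof (vbasis {:V}) (vbasis {:V}) g.

Lemma sym_mapE (g : 'End(V)) p : sym_map g p = lsubst (matrix_of g) p.
Proof.
rewrite lsubstE /sym_map; congr comp_mpoly; apply: eq_from_tnth => i.
rewrite !tnth_mktuple /sym_of_vect; apply: eq_bigr => j _; congr (_ *: _).
by rewrite /matrix_of /passmx.mxof !mxE /= passmx.vecof_delta -tnth_nth.
Qed.

Lemma cubics_act g u c :
  cubics (SL_act_cubics V 4 g u) c = lsubst (matrix_of (val g)) (cubics u c).
Proof. by rewrite /cubics /SL_act_cubics ffunE /= sym_mapE. Qed.

Lemma det_matrix_of g : \det (matrix_of (val g)) = 1.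
Proof. by apply/eqP; case: g. Qed.

Lemma exists_SL (A : 'M[F]_N) : \det A = 1 ->
  exists g : SL V, matrix_of (val g) = A.
Proof.
move=> A1; have bP := vbasisP {:V}.
pose g := passmx.hommx (vbasis {:V}) (vbasis {:V}) A.
have gA : matrix_of g = A by rewrite /matrix_of /g passmx.hommxK.
have g1 : lfun_det g == 1 by rewrite /lfun_det -/(matrix_of g) gA A1.
by exists (exist _ g g1).
Qed.

Definition chain_point (w : 'I_N -> F) : U :=
  [ffun c => DHomog (chain_form_homog w c)].

Lemma cubics_chain_point w : cubics (chain_point w) = chain_form w.
Proof. by apply: funext => c; rewrite /cubics ffunE. Qed.

Lemma cubics_inj u v : cubics u = cubics v -> u = v.
Proof. by move=> uv; apply/ffunP => c; apply/val_inj/(congr1 (@^~ c) uv). Qed.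

Lemma chain_point_sum w :
  chain_point w = \sum_a w a *: chain_point (fun b => (a == b)%:R).
Proof.
apply/ffunP => c; rewrite sum_ffunE; apply: val_inj; rewrite raddf_sum /= ffunE /=.
rewrite /chain_form.
under [RHS]eq_bigr do rewrite !ffunE /= /chain_form scaler_sumr.
rewrite exchange_big /=; apply: eq_bigr => b _.
rewrite (bigD1 b) //= eqxx scale1r big1 ?addr0 // => a /negPf ->.
by rewrite scale0r scaler0.
Qed.

Definition coord_form (a : 'I_#|coord_index N 4|) u : F := coords (cubics u) a.

Lemma coord_form_linear a : scalar (coord_form a).
Proof.
move=> c u v; rewrite /coord_form /coords /cubics !ffunE /=.
by rewrite mcoeffD mcoeffZ.
Qed.

HB.instance Definition _ a := GRing.isLinear.Build F U F *%R (coord_form a)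
  (coord_form_linear a).

End CubicsAction.

(** * The lower bound for [sigma] *)

Section Bound.

Context {R : realType} (V : vectType R[i]).
Local Notation N := (\dim {:V}).
Hypothesis N_gt0 : (0 < N)%N.
Let act := SL_act_cubics V 4.
Let q : {ffun 'I_4 -> Sym V 3} := chain_point (fun=> 1).

Lemma reynolds_homogeneous_invariant m k :
  homogeneous_invariant act (mdeg m) (fun u => reynolds 'X_[m] k (cubics u)).
Proof.
split; last first.
  move=> g u; rewrite (_ : cubics (act g u)
    = fun c => lsubst (matrix_of (val g)) (cubics u c)).
    exact/reynolds_invariant/det_matrix_of.
  by apply: funext => c; apply: cubics_act.
have md : (mpolyX R[i] m) \is homogeneous (mdeg m) by rewrite dhomogX.
have [Q Qd QE] := reynolds_homog k md.
exists #|coord_index N 4|, (@coord_form _ V : _ -> {scalar _}), Q; split=> // u.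
by apply: QE => c; apply/homog_msize/valP.
Qed.

Lemma chain_point_notin_null_cone : ~ null_cone act q.
Proof.
move=> null; apply: (@chain_reynolds_neq0 R[i] N) => p k k0.
rewrite -cubics_chain_point -/q /reynolds (mpolyE p) raddf_sum /= apolar_suml.
apply: big1 => m _; rewrite mmapZ mul_mpolyC apolarZl -/(reynolds _ _ _).
have [m0|m0] := posnP (mdeg m); last first.
  by rewrite (null _ _ m0 (reynolds_homogeneous_invariant m k)) mulr0.
(* Degree 0 is not covered by the null cone: here the pairing is the constant term of [gendet ^+ k],
   a positive power of the determinant of the zero matrix, which is 0 because [N] is positive. *)
move/eqP: m0; rewrite mdeg_eq0 => /eqP ->.
rewrite /reynolds mpolyX0 rmorph1 -mpolyX0 apolarX mcoeff0E rmorphXn /=.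
rewrite (_ : gendet.@[_] = 0) ?expr0n ?gtn_eqF ?mul0r ?mulr0 //.
have det0N j : (0 < j)%N -> \det (0 : 'M[R[i]]_j) = 0.
  by case: j => // j _; exact: det0.
transitivity (eval_mx (0 : 'M[R[i]]_N) gendet); last by rewrite eval_gendet det0N.
by apply: meval_eq => r; rewrite linear0 mxE.
Qed.

(** On the chain points [f] is a form of degree [d] in the weights, invariant under the diagonal
    matrices of determinant 1; any monomial in it would contradict [torus_invariant_degree]. *)
Lemma low_degree_vanishing d f : (0 < d)%N -> (3 * d < N * 2 ^ N.-1)%N ->
  homogeneous_invariant act d f -> f q = 0.
Proof.
move=> d0 dN [[k [l [p [pd fE]]]] finv].
pose L := \matrix_(j < k, a < N) l j (chain_point (fun b => (a == b)%:R)).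
pose g := lsubst L p.
have gE w : f (chain_point w) = g.@[w].
  rewrite fE meval_lsubst; apply: meval_eq => j.
  rewrite chain_point_sum raddf_sum /=; apply: eq_bigr => a _.
  by rewrite linearZ mxE mulrC.
have ginv t w : \prod_i t i = 1 -> g.@[fun a => w a * chain_char t a] = g.@[w].
  move=> t1; have [|h hE] := @exists_SL _ V (diag_mx (\row_i t i)).
    by rewrite det_diag -[RHS]t1; apply: eq_bigr => i _; rewrite mxE.
  rewrite -!gE -[RHS](finv h); congr f; apply: cubics_inj; apply: funext => c.
  by rewrite [RHS]cubics_act hE !cubics_chain_point lsubst_diag_chain.
have gd : g \is homogeneous d by apply: lsubst_homog.
rewrite gE (_ : g = 0) ?meval0 //; apply/msuppnil0.
case E: (msupp g) => [//|e s]; exfalso.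
have eg : e \in msupp g by rewrite E mem_head.
have ed : mdeg e = d by move/dhomogP: gd; apply.
move: dN; rewrite ltnNge -ed => /negP; apply.
by apply: torus_invariant_degree ginv eg _; rewrite ?ed.
Qed.

End Bound.

Theorem theorem1p6 (R : realType) (n : nat) (n_gt0 : (1 <= n)%N)
    (V : vectType R[i]) (dimV : \dim {:V} = (3 * n)%N) :
  (beta (SL_act_cubics V 4) >= sigma (SL_act_cubics V 4))%E /\
  (sigma (SL_act_cubics V 4) >= (2%:R / 3%:R * (4%:R ^+ n - 1))%:E)%E.
Proof.
split; first exact: sigma_le_beta.
have N_gt0 : (0 < \dim {:V})%N by rewrite dimV; lia.
apply: le_ereal_inf_tmp => _ [D nullD <-]; rewrite lee_fin.
have D_ge : (n * 2 ^ (3 * n).-1 <= D)%N.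
  rewrite leqNgt; apply/negP => Dn; apply: (chain_point_notin_null_cone N_gt0).
  rewrite nullD => d f /andP[d0 dD]; apply: low_degree_vanishing => //.
  by rewrite dimV -mulnA ltn_pmul2l //; apply: leq_ltn_trans Dn.
(* With [n = m + 1], this follows from [8 * 2^(2m) <= 12 * (m + 1) * 2^(3m)]. *)
have D_ge' : (2 * 4 ^ n <= 3 * D)%N.
  apply: leq_trans (leq_mul (leqnn 3) D_ge).
  case: n n_gt0 {dimV D_ge} => // m _.
  rewrite -[4%N]/(2 ^ 2)%N -expnM -expnS.
  have -> : ((2 * m.+1).+1 = 3 + 2 * m)%N by lia.
  have -> : ((3 * m.+1).-1 = 2 + 3 * m)%N by lia.
  rewrite !expnD -[(2 ^ 3)%N]/8%N -[(2 ^ 2)%N]/4%N.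
  have : (2 ^ (2 * m) <= 2 ^ (3 * m))%N by rewrite leq_exp2l //; lia.
  nia.
have : 2 * 4%:R ^+ n <= 3 * D%:R :> R by rewrite -natrX -!natrM ler_nat.
by lra.
Qed.
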